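(* For all integers $p,q\ge1$ and every real $r\in[0,2)$, the Kleinberg random network model $\mathbb{KL}(r,p,q)$ is idemetric: there exists a finite-valued function $f$ such that if $G_n$ is sampled from $\mathbb{KL}(r,p,q)$ and $u_n,v_n$ are nodes chosen uniformly at random from $G_n$, then $d(u_n,v_n)/f(n)$ converges in probability to $1$ as $n\to\infty$ (through square numbers $n$).
   Context: Kleinberg model $\mathbb{KL}(r,p,q)$: for a square number $n$, the nodes are the lattice points $\{(x,y):x,y\in\{1,\dots,\sqrt n\}\}$. The lattice distance $d_\ell((x,y),(s,t))$ is the minimum of $|s'-x'|+|t'-y'|$ over $x'\in\{x,x\pm\sqrt n\}$, $y'\in\{y,y\pm\sqrt n\}$, $s'\in\{s,s\pm\sqrt n\}$, $t'\in\{t,t\pm\sqrt n\}$ (periodic boundary). Each node $u$ has a directed edge to every other node within lattice distance $p$. In addition each node $u$ gets $q$ directed long-range edges to nodes chosen by independent random trials, where the $i$th long-range edge from $u$ has endpoint $v$ with probability proportional to $d_\ell(u,v)^{-r}$ (normalised to a probability distribution; for $r=0$ the convention $0^0=1$ is used, so $u$ may be its own contact). $d(a,b)$ is the length of a shortest directed path from $a$ to $b$ ($\infty$ if none). Convergence in probability: for every $\epsilon>0$, $\mathbb{P}(|d(u_n,v_n)/f(n)-1|>\epsilon)\to0$. *)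

(* Defs.v *)
From HB Require Import structures.
From mathcomp Require Import all_boot all_order all_algebra.
From mathcomp Require Import all_classical all_reals all_analysis.
Set Implicit Arguments. Unset Strict Implicit. Unset Printing Implicit Defensive.
Import Order.TTheory GRing.Theory Num.Theory.
Local Open Scope ring_scope.

(* Side length m of the torus; n = m^2 nodes. Coordinates 0..m-1 (a translate
   of 1..sqrt n, which does not affect lattice distances). *)
Notation node m := ('I_m * 'I_m)%type.

Definition shifts (m x : nat) : seq int := [:: x%:Z; x%:Z + m%:Z; x%:Z - m%:Z].

(* Lattice distance: minimum of |s'-x'|+|t'-y'| over all shifted representatives.
   The default value of the iterated min is the (x,y,s,t) candidate itself. *)
Definition latdist (m : nat) (u v : node m) : nat :=
  let x := nat_of_ord u.1 in let y := nat_of_ord u.2 in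
  let s := nat_of_ord v.1 in let t := nat_of_ord v.2 in
  let d0 := (absz (s%:Z - x%:Z) + absz (t%:Z - y%:Z))%N in
  \big[minn/d0]_(x' <- shifts m x) \big[minn/d0]_(y' <- shifts m y)
   \big[minn/d0]_(s' <- shifts m s) \big[minn/d0]_(t' <- shifts m t)
     (absz (s' - x') + absz (t' - y'))%N.

(* Long-range contact configuration: the i-th long-range contact of u. *)
Notation config m q := {ffun node m * 'I_q -> node m}.

Definition kl_edge (m p q : nat) (c : config m q) : rel (node m) :=
  fun u v => ((u != v) && (latdist u v <= p)%N) || [exists i : 'I_q, c (u, i) == v].

Definition has_path (m p q : nat) (c : config m q) (a b : node m) (k : nat) : Prop :=
  exists s : seq (node m), size s = k /\ path (kl_edge p c) a s /\ last a s = b.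

(* d(a,b) = k : k is the length of a shortest directed path from a to b.
   (d(a,b) = infinity iff no such k exists.) *)
Definition kl_dist_is (m p q : nat) (c : config m q) (a b : node m) (k : nat) : Prop :=
  has_path p c a b k /\ (forall j, (j < k)%N -> ~ has_path p c a b j).

(* Weight d_l(u,v)^(-r); powR 0 0 = 1 (convention 0^0 = 1), and for r > 0 the
   node u itself gets weight 0 (it cannot be its own contact). *)
Definition lr_weight (R : realType) (r : R) (m : nat) (u v : node m) : R :=
  ((latdist u v)%:R) `^ (- r).

Definition lr_prob (R : realType) (r : R) (m : nat) (u v : node m) : R :=
  lr_weight r u v / \sum_(w : node m) lr_weight r u w.

Definition config_prob (R : realType) (r : R) (m q : nat) (c : config m q) : R :=
  \prod_(ui : node m * 'I_q) lr_prob r ui.1 (c ui).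

(* Probability, for G sampled from KL(r,p,q) on n = m^2 nodes and u, v chosen
   independently and uniformly, that |d(u,v)/fn - 1| > eps (including d = oo). *)
Definition bad_prob (R : realType) (r : R) (p q m : nat) (fn eps : R) : R :=
  \sum_(c : config m q) \sum_(u : node m) \sum_(v : node m)
    (if `[< ~ (exists k, kl_dist_is p c u v k /\ `|k%:R / fn - 1| <= eps) >]
     then config_prob r c / (#|{: node m}|%:R ^+ 2) else 0).

(* Main.v *)
Require Import Defs.
From HB Require Import structures.
From mathcomp Require Import all_boot all_order all_algebra.
From mathcomp Require Import all_classical all_reals all_analysis.
From mathcomp Require Import zify ring lra.
Import Order.TTheory GRing.Theory Num.Theory.
Import numFieldNormedType.Exports.
Set Implicit Arguments. Unset Strict Implicit. Unset Printing Implicit Defensive.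

(* Every ball of radius t around u has at most N_t points, where N_t is the size of
   the ideal ball in which no two long-range edges interfere: each of them opens a
   disjoint lattice ball. N_t grows geometrically and does not depend on the side m.
   Let T be the largest t with N_t (t + 1) <= n; then d(u, v) > T outside an event of
   probability N_T / n. Conversely, since r < 2, an edge falls into a given set of size
   a with probability O((a / n)^(1 - r/2)), so the expected relative loss to collisions
   up to time T is a geometric sum dominated by its last term, and tends to 0. Hence
   whp the sphere of radius T contains N_T / 4 points, whose contacts are still
   independent of everything seen so far, and any point is hit with probability at
   least c / n. One of them lands within lattice distance p rho of v, where
   rho = o(T) and N_T rho^2 / n tends to infinity. Thus T < d(u, v) <= T + 1 + rho. *)

Local Open Scope nat_scope.

(** * Lattice balls on the torus *)

(** Distance on the cycle of length m; with truncated subtraction, [(a - b) + (b - a)] is the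
    absolute difference. *)
Definition cdist m (a b : 'I_m) : nat :=
  minn ((a - b) + (b - a)) (m - ((a - b) + (b - a))).

Lemma bigminn_le (I : eqType) (s : seq I) (F : I -> nat) d i :
  i \in s -> \big[minn/d]_(j <- s) F j <= F i.
Proof.
elim: s => // j s IH; rewrite inE big_cons geq_min => /orP[/eqP->|/IH->].
  by rewrite leqnn.
by rewrite orbT.
Qed.

Lemma shifts_dist m (a b : 'I_m) (a' b' : int) :
  a' \in shifts m a -> b' \in shifts m b -> cdist a b <= absz (b' - a').
Proof.
by have := ltn_ord a; have := ltn_ord b; rewrite /cdist !inE;
  move=> ? ? /or3P[] /eqP-> /or3P[] /eqP->; lia.
Qed.

Lemma bigminn_ge_in (I : eqType) (s : seq I) (F : I -> nat) d k :
  k <= d -> (forall i, i \in s -> k <= F i) -> k <= \big[minn/d]_(i <- s) F i.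
Proof.
move=> kd kF; rewrite big_seq.
by elim/big_ind: _ => // x y kx ky; rewrite leq_min kx.
Qed.

Lemma shifts_attained m (a b : 'I_m) :
  exists2 x, x \in shifts m a & exists2 y, y \in shifts m b & absz (y - x) = cdist a b.
Proof.
have ha := ltn_ord a; have hb := ltn_ord b.
have [le|lt] := leqP ((a - b) + (b - a)) (m - ((a - b) + (b - a))).
  exists (Posz a); first by rewrite !inE eqxx.
  by exists (Posz b); [rewrite !inE eqxx | rewrite /cdist; lia].
exists (Posz a); first by rewrite !inE eqxx.
have [ab|ab] := leqP a b.
  by exists (Posz b - Posz m)%R; [rewrite !inE eqxx !orbT | rewrite /cdist; lia].
by exists (Posz b + Posz m)%R; [rewrite !inE eqxx !orbT | rewrite /cdist; lia].
Qed.

(** The coordinates are minimised independently: every pair of shifts is at least the cyclic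
    distance apart and some pair attains it. All later arguments use this form. *)
Lemma latdistE m (u v : node m) :
  latdist u v = cdist u.1 v.1 + cdist u.2 v.2.
Proof.
have h1 : cdist u.1 v.1 <= absz (Posz v.1 - Posz u.1).
  by apply: shifts_dist; rewrite !inE eqxx.
have h2 : cdist u.2 v.2 <= absz (Posz v.2 - Posz u.2).
  by apply: shifts_dist; rewrite !inE eqxx.
(* The default of the iterated minima is the unshifted candidate, so it too needs the lower
   bound. *)
have h12 := leq_add h1 h2.
apply/eqP; rewrite eqn_leq /latdist; apply/andP; split; last first.
  apply: bigminn_ge_in => // x' hx'; apply: bigminn_ge_in => // y' hy'.
  apply: bigminn_ge_in => // s' hs'; apply: bigminn_ge_in => // t' ht'.
  by apply: leq_add; apply: shifts_dist.
have [x hx [s hs <-]] := shifts_attained u.1 v.1.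
have [y hy [t ht <-]] := shifts_attained u.2 v.2.
apply: leq_trans (bigminn_le _ _ hx) _.
apply: leq_trans (bigminn_le _ _ hy) _.
apply: leq_trans (bigminn_le _ _ hs) _.
exact: leq_trans (bigminn_le _ _ ht) _.
Qed.

Lemma cdist_refl m (a : 'I_m) : cdist a a = 0.
Proof. by rewrite /cdist subnn min0n. Qed.

Lemma cdist_sym m (a b : 'I_m) : cdist a b = cdist b a.
Proof. by rewrite /cdist addnC. Qed.

Lemma cdist_tri m (b a d : 'I_m) : cdist a d <= cdist a b + cdist b d.
Proof.
by have := ltn_ord a; have := ltn_ord b; have := ltn_ord d; rewrite /cdist; lia.
Qed.

Lemma cdist_half m (a b : 'I_m) : (cdist a b).*2 <= m.
Proof. by have := ltn_ord a; have := ltn_ord b; rewrite /cdist; lia. Qed.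

Lemma cdist_eq0 m (a b : 'I_m) : cdist a b = 0 -> a = b.
Proof.
by have := ltn_ord a; have := ltn_ord b; rewrite /cdist => ? ? ?; apply/val_inj => /=; lia.
Qed.

Lemma wrap_up m (a : 'I_m) j : j < m -> (if a + j < m then a + j else a + j - m) < m.
Proof. by have := ltn_ord a; case: ifP; lia. Qed.

Lemma wrap_down m (a : 'I_m) j : j < m -> (if j <= a then a - j else a + m - j) < m.
Proof. by have := ltn_ord a; case: ifP; lia. Qed.

(** Move [b] one unit along the shorter arc towards [a]; whether that arc wraps around decides the
    direction. *)
Lemma cdist_step m (a b : 'I_m) k : cdist a b = k.+1 ->
  exists2 d, cdist a d = k & cdist d b = 1.
Proof.
have ha := ltn_ord a; have hb := ltn_ord b => hk.
have m1 : 1 < m by move: hk; rewrite /cdist; lia.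
have hup := wrap_up b m1; have hdn := wrap_down b m1.
have [le|lt] := leqP ((a - b) + (b - a)) (m - ((a - b) + (b - a)));
  have [ab|ab] := leqP a b; move: hk; rewrite /cdist => hk.
- exists (Ordinal hdn) => /=; [case: ifP | case: ifP]; lia.
- exists (Ordinal hup) => /=; [case: ifP | case: ifP]; lia.
- exists (Ordinal hup) => /=; [case: ifP | case: ifP]; lia.
- exists (Ordinal hdn) => /=; [case: ifP | case: ifP]; lia.
Qed.

Definition csphere j := if j is 0 then 1 else 2.

Lemma card_cdist_le m (a : 'I_m) j : #|[set b | cdist a b == j]| <= csphere j.
Proof.
have ha := ltn_ord a.
case: (leqP m j) => [mj|jm].
  rewrite (_ : [set b | _] = finset.set0) ?cards0 //.
  apply/setP => b; rewrite !inE; apply/negbTE.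
  by have := ltn_ord b; rewrite /cdist; lia.
case: j jm => [|j] jm.
  rewrite /= -(cards1 a); apply/subset_leq_card/fintype.subsetP => b.
  by rewrite !inE => /eqP/cdist_eq0->.
apply: (@leq_trans #|[set Ordinal (wrap_up a jm); Ordinal (wrap_down a jm)]|).
  apply/subset_leq_card/fintype.subsetP => b; rewrite !inE -!val_eqE /=.
  have := ltn_ord b; rewrite /cdist; do 2 case: ifP; lia.
by rewrite cards2; case: eqP.
Qed.

(** Below half the circumference, going [j > 0] steps either way ends at two distinct points. *)
Lemma card_cdist m (a : 'I_m) j : j.*2 < m -> #|[set b | cdist a b == j]| = csphere j.
Proof.
move=> jm; apply/eqP; rewrite eqn_leq card_cdist_le /=.
have ha := ltn_ord a.
case: j jm => [|j] jm /=.
  rewrite /= -(cards1 a); apply/subset_leq_card/fintype.subsetP => b.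
  by rewrite !inE => /eqP->; rewrite cdist_refl.
have jm' : j.+1 < m by lia.
have ne : Ordinal (wrap_up a jm') != Ordinal (wrap_down a jm').
  by rewrite -val_eqE /=; do 2 case: ifP; lia.
have -> : 2 = #|[set Ordinal (wrap_up a jm'); Ordinal (wrap_down a jm')]|.
  by rewrite cards2 ne.
apply/subset_leq_card/fintype.subsetP => b; rewrite !inE -!val_eqE /=.
have := ltn_ord b; rewrite /cdist; do 2 case: ifP; lia.
Qed.

(** [lsphere] and [ell] are the sizes of the l1 spheres and balls of the infinite square lattice;
    the torus agrees with it for radii below m/2. *)
Definition lsphere j := if j is 0 then 1 else 4 * j.
Definition ell k := 2 * k ^ 2 + 2 * k + 1.

Lemma ell_sum k : ell k = \sum_(j < k.+1) lsphere j.
Proof.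
elim: k => [|k IH]; first by rewrite big_ord1.
by rewrite big_ord_recr -IH /= /ell; lia.
Qed.

Lemma csphere_conv j : \sum_(i < j.+1) csphere i * csphere (j - i) = lsphere j.
Proof.
case: j => [|j]; first by rewrite big_ord1.
rewrite big_ord_recr big_ord_recl /= subnn /=.
rewrite (eq_bigr (fun=> 4)) ?sum_nat_const ?card_ord; first by lia.
by move=> i _; rewrite /bump /= (_ : j.+1 - i.+1 = (j - i.+1).+1) //; have := ltn_ord i; lia.
Qed.

Lemma card_latsphereE m (u : node m) j :
  #|[set v | latdist u v == j]| =
  \sum_(i < j.+1) #|[set a | cdist u.1 a == i]| * #|[set b | cdist u.2 b == j - i]|.
Proof.
under eq_bigr => i _ do rewrite -cardsX.
under eq_bigr => i _ do rewrite -sum1_card.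
rewrite -sum1_card.
symmetry.
rewrite (exchange_big_dep (fun v => latdist u v == j)) /=; last first.
  move=> i v _; rewrite !inE latdistE => /andP[/eqP-> /eqP->].
  by rewrite subnKC // -ltnS.
apply: eq_big => v; first by rewrite inE.
rewrite latdistE => /eqP hv.
have hi : cdist u.1 v.1 < j.+1 by lia.
rewrite (bigD1 (Ordinal hi)) /=; last by rewrite !inE eqxx -hv addKn eqxx.
rewrite big1 ?addn0 // => i; rewrite !inE -val_eqE /= eq_sym.
by case/andP=> /andP[/eqP->]; rewrite eqxx.
Qed.

Lemma card_latsphere_le m (u : node m) j : #|[set v | latdist u v == j]| <= lsphere j.
Proof.
rewrite card_latsphereE -csphere_conv; apply: leq_sum => i _.
by apply: leq_mul; apply: card_cdist_le.
Qed.

Lemma card_latsphere m (u : node m) j :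
  j.*2 < m -> #|[set v | latdist u v == j]| = lsphere j.
Proof.
move=> jm; rewrite card_latsphereE -csphere_conv; apply: eq_bigr => i _.
by rewrite !card_cdist //; have := ltn_ord i; lia.
Qed.

Definition lball m k (w : node m) := [set x | latdist w x <= k].

Lemma card_lballE m k (w : node m) :
  #|lball k w| = \sum_(j < k.+1) #|[set v | latdist w v == j]|.
Proof.
elim: k => [|k IH].
  by rewrite big_ord1; apply: eq_card => x; rewrite !inE leqn0.
rewrite big_ord_recr -IH /= -cardsUI -[LHS]addn0; congr addn.
  by apply: eq_card => x; rewrite !inE leq_eqVlt orbC ltnS.
symmetry; apply/eqP; rewrite cards_eq0; apply/eqP/setP => x; rewrite !inE.
by apply/negbTE; lia.
Qed.

Lemma card_lball_le m k (w : node m) : #|lball k w| <= ell k.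
Proof.
by rewrite card_lballE ell_sum; apply: leq_sum => j _; apply: card_latsphere_le.
Qed.

Lemma card_lball m k (w : node m) : k.*2 < m -> #|lball k w| = ell k.
Proof.
move=> km; rewrite card_lballE ell_sum; apply: eq_bigr => j _.
by rewrite card_latsphere //; have := ltn_ord j; lia.
Qed.

Lemma latdist_refl m (u : node m) : latdist u u = 0.
Proof. by rewrite latdistE !cdist_refl. Qed.

Lemma latdist_sym m (u v : node m) : latdist u v = latdist v u.
Proof. by rewrite !latdistE ![cdist (u.1) _]cdist_sym ![cdist (u.2) _]cdist_sym. Qed.

Lemma latdist_tri m (v u w : node m) : latdist u w <= latdist u v + latdist v w.
Proof.
rewrite !latdistE addnACA; apply: leq_add; exact: cdist_tri.
Qed.

Lemma latdist_le m (u v : node m) : latdist u v <= m.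
Proof.
by rewrite latdistE; have := cdist_half u.1 v.1; have := cdist_half u.2 v.2; lia.
Qed.

Lemma latdist_eq0 m (u v : node m) : latdist u v = 0 -> u = v.
Proof.
by case: u v => a b [a' b']; rewrite latdistE /= => /eqP; rewrite addn_eq0
  => /andP[/eqP/cdist_eq0-> /eqP/cdist_eq0->].
Qed.

Lemma latdist_step m (u v : node m) k : latdist u v = k.+1 ->
  exists2 w, latdist u w = k & latdist w v = 1.
Proof.
case: u v => a b [a' b']; rewrite latdistE /=.
case E : (cdist a a') => [|i] /= h.
  have [d h1 h2] : exists2 d, cdist b d = k & cdist d b' = 1 by exact: cdist_step.
  by exists (a', d); rewrite !latdistE /= ?E ?h1 ?h2 ?cdist_refl.
have [d h1 h2] := cdist_step E.
by exists (d, b'); rewrite !latdistE /= ?h1 ?h2 ?cdist_refl //; lia.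
Qed.

(** Walk back from [v] by unit steps. This is what cuts a lattice distance of at most [p * k] into k
    short edges. *)
Lemma latdist_split m (u v : node m) i j : latdist u v <= i + j ->
  exists2 w, latdist u w <= i & latdist w v <= j.
Proof.
elim: j v => [|j IH] v h.
  by exists v; [rewrite -(addn0 i) | rewrite latdist_refl].
have [h'|h'] := leqP (latdist u v) (i + j).
  by have [w h1 h2] := IH v h'; exists w => //; apply: leqW.
have E : latdist u v = (i + j).+1 by lia.
have [x h1 h2] := latdist_step E.
have [w w1 w2] := IH x (eq_leq h1).
by exists w => //; have := latdist_tri x w v; lia.
Qed.

(** * The ideal growth sequence *)

(* Number of lattice points first covered at the [j]-th step of [p]-jumps. *)
Definition sig p j := if j is i.+1 then ell (p * j) - ell (p * i) else 1.

Lemma ell_homo : {homo ell : i j / i <= j}.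
Proof. by move=> i j ij; rewrite /ell leq_add2r leq_add ?leq_mul ?leq_exp2r. Qed.

(** The difference is a polynomial with nonnegative coefficients. Enlarging a radius thus costs only
    a factor in volume. *)
Lemma ell_addM i j : ell (i + j) <= ell i * ell j.
Proof.
rewrite (_ : ell i * ell j = ell (i + j) +
  (4 * i ^ 2 * j ^ 2 + 4 * i ^ 2 * j + 4 * i * j ^ 2)) ?leq_addr //.
by rewrite /ell; ring.
Qed.

Lemma sigS p j : sig p j.+2 = 2 * p ^ 2 * (2 * j + 3) + 2 * p.
Proof.
rewrite /= (_ : ell (p * j.+2) = ell (p * j.+1) + (2 * p ^ 2 * (2 * j + 3) + 2 * p)).
  by rewrite addKn.
by rewrite /ell; ring.
Qed.

Lemma sig1 p : sig p 1 = 2 * p ^ 2 + 2 * p.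
Proof. by rewrite /= /ell; lia. Qed.

Lemma ell_sig p j : ell (p * j) = \sum_(i < j.+1) sig p i.
Proof.
elim: j => [|j IH]; first by rewrite big_ord1 muln0.
by rewrite big_ord_recr -IH /= subnKC // ell_homo // leq_mul2l leqnSn orbT.
Qed.

Lemma sig_homo p j : 0 < p -> sig p j <= sig p j.+1.
Proof.
by move=> p0; case: j => [|[|j]]; rewrite ?sigS ?sig1 //=; nia.
Qed.

Lemma sig_ratio p j : 0 < p -> sig p j.+1 <= ell p * sig p j.
Proof.
move=> p0; case: j => [|[|j]]; rewrite ?sigS ?sig1 /=.
- by rewrite muln1 /ell; lia.
- have : 5 <= ell p by rewrite /ell; nia.
  by nia.
- have : 5 <= ell p by rewrite /ell; nia.
  by nia.
Qed.

(** Summation by parts: [ell] is the cumulative sum of [sig], so weights on spheres become weights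
    on balls. *)
Lemma sum_parts p (S : nat -> nat) t :
  \sum_(s < t) S s * ell (p * (t.-1 - s)) =
  \sum_(s < t) sig p (t.-1 - s) * \sum_(i < s.+1) S i.
Proof.
under [RHS]eq_bigr => s _ do rewrite big_distrr /=.
under [RHS]eq_bigr => s _.
  rewrite (big_ord_widen t (fun i => sig p (t.-1 - s) * S i)) //.
  over.
rewrite (exchange_big_dep xpredT) //=; apply: eq_bigr => i _.
have it := ltn_ord i.
rewrite ell_sig -big_distrl /= mulnC; congr muln.
rewrite -(big_mkord xpredT (sig p)) big_nat_rev /=.
rewrite -(big_mkord (fun s => i < s.+1) (fun s => sig p (t.-1 - s))).
rewrite (big_cat_nat (leq0n i) (ltnW it)) /=.
rewrite [\sum_(0 <= s < i | _) _]big_nat_cond.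
rewrite (big_pred0 _ _ _ (P := fun s => (0 <= s < i) && (i < s.+1))) ?add0n;
  last by move=> s; lia.
have -> : \sum_(i <= s < t | i < s.+1) sig p (t.-1 - s) =
          \sum_(0 <= s < t - i) sig p (t.-1 - (s + i)).
  rewrite -{1}[nat_of_ord i]add0n big_addn big_nat_cond [RHS]big_nat_cond.
  by apply: eq_bigl => s; lia.
rewrite (_ : (t.-1 - i).+1 = t - i); last by lia.
rewrite big_nat_cond [RHS]big_nat_cond; apply: eq_bigr => s h.
by congr sig; lia.
Qed.

(* [growth] is specified by [growth_rec]; the list encodes course-of-values recursion. *)
Fixpoint growth_list p q t : seq nat :=
  if t is t'.+1 then
    let l := growth_list p q t' in
    rcons l (ell (p * t) + q * \sum_(s < t) sig p (t' - s) * nth 0 l s)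
  else [:: 1].

Definition growth p q t := nth 0 (growth_list p q t) t.

Lemma size_growth_list p q t : size (growth_list p q t) = t.+1.
Proof. by elim: t => //= t IH; rewrite size_rcons IH. Qed.

Lemma nth_growth_list p q t s : s <= t -> nth 0 (growth_list p q t) s = growth p q s.
Proof.
elim: t => [|t IH]; first by rewrite leqn0 => /eqP->.
by rewrite leq_eqVlt => /orP[/eqP->//|st]; rewrite /= nth_rcons size_growth_list st IH.
Qed.

(** The recursion of [volumeE], with every earlier ball at its largest possible size. *)
Lemma growth_rec p q t :
  growth p q t = ell (p * t) + q * \sum_(s < t) sig p (t.-1 - s) * growth p q s.
Proof.
case: t => [|t]; first by rewrite big_ord0 !muln0.
rewrite {1}/growth /= nth_rcons size_growth_list ltnn eqxx; congr (_ + _ * _).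
by apply: eq_bigr => s _; rewrite nth_growth_list // -ltnS.
Qed.

(** From t to t + 1 no weight [sig] decreases, and the new summand s = t, of weight [sig p 0 = 1],
    contributes q N_t. *)
Lemma growth_double p q t : 0 < p -> 0 < q -> 2 * growth p q t <= growth p q t.+1.
Proof.
move=> p0 q0; rewrite [growth p q t.+1]growth_rec big_ord_recr /= subnn /= mul1n.
rewrite mulnDr addnA mul2n -addnn leq_add //; last exact: leq_pmull.
rewrite [growth p q t]growth_rec leq_add ?ell_homo ?leq_mul2l ?leqnSn ?orbT //.
apply/orP; right; apply: leq_sum => s _; rewrite leq_mul2r; apply/orP; right.
by rewrite (_ : t - s = (t.-1 - s).+1) ?sig_homo //; have := ltn_ord s; lia.
Qed.

(** Each old summand grows by a factor of at most [ell p], and the new one is q N_t. This later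
    bounds N_T from below through the maximality of T. *)
Lemma growth_ratio p q t : 0 < p -> growth p q t.+1 <= (ell p + q) * growth p q t.
Proof.
move=> p0; rewrite [growth p q t.+1]growth_rec big_ord_recr /= subnn /= mul1n.
rewrite mulnDr addnA mulnDl leq_add //.
rewrite [growth p q t]growth_rec mulnDr leq_add //.
  by rewrite mulnS ell_addM.
rewrite mulnCA leq_mul2l big_distrr; apply/orP; right; apply: leq_sum => s _ /=.
rewrite mulnA leq_mul2r; apply/orP; right.
by rewrite (_ : t - s = (t.-1 - s).+1) ?sig_ratio //; have := ltn_ord s; lia.
Qed.

Lemma growth_expn p q s j : 0 < p -> 0 < q -> 2 ^ j * growth p q s <= growth p q (s + j).
Proof.
move=> p0 q0; elim: j => [|j IH]; first by rewrite mul1n addn0.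
rewrite expnS -mulnA addnS; apply: leq_trans (growth_double _ p0 q0).
by rewrite leq_mul2l IH.
Qed.

(** * Exploration from a vertex *)

Lemma sum_card_disjoint (I T : finType) (P : pred I) (X : I -> {set T}) (A : {set T}) :
  (forall i, P i -> X i \subset A) ->
  (forall i j, P i -> P j -> i != j -> [disjoint X i & X j]) ->
  \sum_(i | P i) #|X i| <= #|A|.
Proof.
move=> subA disj; rewrite -sum1_card.
under eq_bigr => i _ do rewrite -sum1_card.
rewrite (exchange_big_dep (mem A)) /=; last first.
  by move=> i x Pi; apply: (fintype.subsetP (subA i Pi)).
apply: leq_sum => x _.
have [i /andP[Pi xi]|none] := pickP (fun i => P i && (x \in X i)); last by rewrite big_pred0.
rewrite (bigD1 i) ?Pi //= big_pred0 // => j.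
apply/negbTE; apply/negP => /andP[/andP[Pj xj] ji].
by have /pred0P/(_ x) := disj _ _ Pj Pi ji; rewrite /= xj xi.
Qed.

Section Exploration.
Variables (m p q : nat).
Implicit Types (c : config m q) (u x y : node m) (e : node m * 'I_q).

Fixpoint gball c u t : {set node m} :=
  if t is t'.+1 then
    gball c u t' :|: [set w | [exists y, (y \in gball c u t') && kl_edge p c y w]]
  else [set u].

Definition gsphere c u t :=
  if t is t'.+1 then gball c u t :\: gball c u t' else gball c u t.

Lemma gball_mono c u s t : s <= t -> gball c u s \subset gball c u t.
Proof.
move=> /subnK <-; elim: (t - s) => [|k IH] //.
by apply: (fintype.subset_trans IH); rewrite /= finset.subsetUl.
Qed.

Lemma gball_edge c u t x y : x \in gball c u t -> kl_edge p c x y -> y \in gball c u t.+1.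
Proof.
by move=> xt xy; rewrite /= !inE; apply/orP; right; apply/existsP; exists x; rewrite xt.
Qed.

Lemma gball_contact c u t e : e.1 \in gball c u t -> c e \in gball c u t.+1.
Proof.
move=> h; apply: (gball_edge h); rewrite /kl_edge; apply/orP; right.
by apply/existsP; exists e.2; case: (e).
Qed.

Lemma gball_lball c u t k x y :
  x \in gball c u t -> latdist x y <= p * k -> y \in gball c u (t + k).
Proof.
elim: k x y => [|k IH] x y xt.
  by rewrite muln0 leqn0 addn0 => /eqP/latdist_eq0 <-.
rewrite mulnS addnC => /latdist_split[w xw wy].
have wk := IH _ _ xt xw; rewrite addnS.
(* A jump of length zero is not a short edge; [y] is then in the earlier ball already. *)
have [<-|ne] := eqVneq w y; first exact: (fintype.subsetP (gball_mono c u (leqnSn _))).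
by apply: (gball_edge wk); rewrite /kl_edge ne wy.
Qed.

Lemma gsphere_sub c u t : gsphere c u t \subset gball c u t.
Proof. by case: t => //= t; apply: finset.subsetDl. Qed.

Lemma gsphere_notin c u s t x : s < t -> x \in gsphere c u t -> x \notin gball c u s.
Proof.
case: t => // t; rewrite ltnS => st /setDP[_]; apply: contra.
exact: (fintype.subsetP (gball_mono c u st)).
Qed.

Lemma gsphere_inj c u s t x : x \in gsphere c u s -> x \in gsphere c u t -> s = t.
Proof.
move=> xs xt; have [st|ts|//] := ltngtP s t.
- by have := gsphere_notin st xt; rewrite (fintype.subsetP (gsphere_sub c u s)).
- by have := gsphere_notin ts xs; rewrite (fintype.subsetP (gsphere_sub c u t)).
Qed.

Lemma gball_gsphere c u t x :
  x \in gball c u t -> exists2 s, s <= t & x \in gsphere c u s.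
Proof.
elim: t => [|t IH] xt; first by exists 0.
have [/IH[s st xs]|nx] := boolP (x \in gball c u t).
  by exists s => //; apply: leqW.
by exists t.+1 => //; rewrite /gsphere inE nx.
Qed.

Lemma card_gball c u t : #|gball c u t| = \sum_(s < t.+1) #|gsphere c u s|.
Proof.
elim: t => [|t IH]; first by rewrite big_ord1.
rewrite big_ord_recr -IH /= cardsD.
rewrite (finset.setIidPr (gball_mono c u (leqnSn t))) subnKC //.
exact: subset_leq_card (gball_mono c u (leqnSn t)).
Qed.

Lemma has_path_gball c u k x : has_path p c u x k -> x \in gball c u k.
Proof.
case=> s [<- [+ <-]]; elim/last_ind: s => [|s y IH]; first by rewrite inE.
rewrite rcons_path last_rcons size_rcons => /andP[/IH h xy].
exact: gball_edge xy.
Qed.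

Lemma gball_has_path c u t x :
  x \in gball c u t -> exists2 k, k <= t & has_path p c u x k.
Proof.
elim: t x => [|t IH] x.
  by rewrite inE => /eqP->; exists 0 => //; exists [::].
rewrite /= !inE => /orP[/IH[k kt h]|/existsP[y /andP[/IH[k kt [s [sk [ps ls]]]] yx]]].
  by exists k => //; apply: leqW.
exists k.+1 => //; exists (rcons s x).
by rewrite size_rcons sk rcons_path ps last_rcons ls.
Qed.

Lemma kl_dist_exists c u x s t : x \notin gball c u s -> x \in gball c u t ->
  exists k, [/\ kl_dist_is p c u x k, s < k & k <= t].
Proof.
move=> xs xt.
have ex : exists k, x \in gball c u k by exists t.
case: (ex_minnP ex) => k xk mink.
have [k' k'k h] := gball_has_path xk.
have kk' := mink _ (has_path_gball h).
have E : k' = k by apply/eqP; rewrite eqn_leq k'k.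
exists k; split; last exact: mink.
- split; first by rewrite -E.
  by move=> j jk /has_path_gball/mink; rewrite leqNgt jk.
- rewrite ltnNge; apply: contra xs => ks.
  exact: (fintype.subsetP (gball_mono c u ks)).
Qed.

(* An edge [j.2] leaving the sphere of radius [j.1 < t] plants the lattice ball
   [seed_ball c j], filled completely at time [t]. *)
Section Seeds.
Variable t : nat.
Local Notation J := ('I_t * (node m * 'I_q))%type.
Implicit Types j : J.

Definition seed c u j := j.2.1 \in gsphere c u j.1.
Definition seed_ball c j := lball (p * (t.-1 - j.1)) (c j.2).

Lemma seed_ball_sub c u j : seed c u j -> seed_ball c j \subset gball c u t.
Proof.
move=> sj; apply/fintype.subsetP => x; rewrite inE => h.
have jt := ltn_ord j.1.
(* One step is spent on the long-range edge itself, which leaves [t.-1 - j.1] jumps. *)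
rewrite (_ : t = j.1.+1 + (t.-1 - j.1)); last by lia.
apply: gball_lball h; apply: gball_contact.
exact: (fintype.subsetP (gsphere_sub c u j.1)).
Qed.

Lemma sum_seed c u (g : nat -> nat) :
  \sum_(j : J | seed c u j) g j.1 = q * \sum_(s < t) #|gsphere c u s| * g s.
Proof.
rewrite -(pair_big_dep xpredT (fun (s : 'I_t) e => e.1 \in gsphere c u s) (fun s _ => g s)) /=.
rewrite big_distrr /=; apply: eq_bigr => s _.
rewrite (_ : \sum_(e | e.1 \in gsphere c u s) g s =
    \sum_(e in finset.setX (gsphere c u s) [set: 'I_q]) g s); last first.
  by apply: eq_bigl => e; rewrite !inE andbT.
by rewrite sum_nat_const cardsX cardsT card_ord mulnA [q * _]mulnC.
Qed.

End Seeds.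

(* Total size of all balls planted by time [t], counted as if disjoint. *)
Definition volume c u t :=
  ell (p * t) + q * \sum_(s < t) #|gsphere c u s| * ell (p * (t.-1 - s)).

Lemma volumeE c u t :
  volume c u t = ell (p * t) + q * \sum_(s < t) sig p (t.-1 - s) * #|gball c u s|.
Proof.
rewrite /volume (sum_parts p (fun s => #|gsphere c u s|)); congr (_ + q * _).
by apply: eq_bigr => s _; rewrite card_gball.
Qed.

(** On a path to [x] only the last long-range edge matters: the short edges after it stay in the
    ball planted at its endpoint. *)
Lemma gball_cover c u t x : x \in gball c u t ->
  x \in lball (p * t) u \/
  exists2 j : 'I_t * (node m * 'I_q), seed c u j & x \in seed_ball c j.
Proof.
elim: t x => [|t IH] x.
  by rewrite inE => /eqP->; left; rewrite inE latdist_refl.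
have lift (y : node m) : y \in gball c u t -> latdist y x <= p ->
    x \in lball (p * t.+1) u \/
    exists2 j : 'I_t.+1 * (node m * 'I_q), seed c u j & x \in seed_ball c j.
  move=> /IH[|[j sj]]; rewrite !inE => h yx.
    by left; have := latdist_tri y u x; rewrite mulnS; lia.
  right; exists (widen_ord (leqnSn t) j.1, j.2) => //; rewrite inE /=.
  have := latdist_tri y (c j.2) x; have jt := ltn_ord j.1.
  by rewrite (_ : t - j.1 = (t.-1 - j.1).+1) ?mulnS; lia.
case/setUP=> [h|]; first by apply: (lift x); rewrite ?latdist_refl.
rewrite inE => /existsP[y /andP[yt]].
case/orP=> [/andP[_]|/existsP[i /eqP ci]]; first exact: lift.
have [s st ys] := gball_gsphere yt.
right; exists (Ordinal (st : s < t.+1), (y, i)) => //.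
by rewrite inE ci latdist_refl.
Qed.

Lemma card_gball_volume c u t : #|gball c u t| <= volume c u t.
Proof.
rewrite /volume -(sum_seed t c u (fun s => ell (p * (t.-1 - s)))).
pose F := \bigcup_(j : 'I_t * (node m * 'I_q) | seed c u j) seed_ball c j.
apply: (@leq_trans #|lball (p * t) u :|: F|).
  apply/subset_leq_card/fintype.subsetP => x /gball_cover[h|[j sj h]]; rewrite inE.
    by rewrite h.
  by apply/orP; right; apply/bigcupP; exists j.
apply: leq_trans (leq_card_setU _ _).1 _.
apply: leq_add; first exact: card_lball_le.
rewrite /F; elim/big_ind2: _ => [|A a B b hA hB|j _]; first by rewrite cards0.
  by apply: leq_trans (leq_card_setU _ _).1 _; apply: leq_add.
exact: card_lball_le.
Qed.

(** By [volumeE] the volume is a nonnegative combination of earlier ball sizes, so the bound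
    propagates by strong induction, for every configuration. *)
Lemma volume_growth c u t : volume c u t <= growth p q t.
Proof.
elim/ltn_ind: t => t IH; rewrite volumeE growth_rec leq_add2l leq_mul2l.
apply/orP; right; apply: leq_sum => s _; rewrite leq_mul2l; apply/orP; right.
by apply: leq_trans (card_gball_volume _ _ _) _; apply: IH.
Qed.

Lemma card_gball_growth c u t : #|gball c u t| <= growth p q t.
Proof. exact: leq_trans (card_gball_volume _ _ _) (volume_growth _ _ _). Qed.

(** * Collisions between planted balls *)

Section Collision.
Variable t : nat.
Local Notation J := ('I_t * (node m * 'I_q))%type.

(* Landing places for an edge [e] leaving the sphere of radius [s] whose planted
   ball would meet the root ball or another planted ball of no later date. *)
Definition danger c u (s : 'I_t) e : {set node m} :=
  [set w | ~~ [disjoint lball (p * t) u & lball (p * (t.-1 - s)) w] ||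
    [exists j : J, [&& seed c u j, j.2 != e, j.1 <= s &
      ~~ [disjoint seed_ball c j & lball (p * (t.-1 - s)) w]]]].

Definition collides c u (j : J) := c j.2 \in danger c u j.1 j.2.

(** Balls of non-colliding seeds avoid the root ball and one another: of two such seeds, the one of
    later or equal date avoids the other. None wraps around, so each has full size. *)
Lemma card_gball_ge c u : (p * t).*2 < m ->
  ell (p * t) + \sum_(j : J | seed c u j && ~~ collides c u j) ell (p * (t.-1 - j.1))
    <= #|gball c u t|.
Proof.
move=> tm.
have nm (j : J) : (p * (t.-1 - j.1)).*2 < m.
  apply: leq_ltn_trans tm; rewrite leq_double leq_mul2l.
  by apply/orP; right; lia.
have disj j : seed c u j && ~~ collides c u j -> [disjoint lball (p * t) u & seed_ball c j].
  by case/andP=> _; rewrite /collides inE negb_or negbK => /andP[].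
have disj2 (j j' : J) : seed c u j -> seed c u j' -> j' != j -> j'.1 <= j.1 ->
    ~~ collides c u j -> [disjoint seed_ball c j' & seed_ball c j].
  move=> sj sj' ne le; rewrite /collides inE negb_or => /andP[_].
  rewrite negb_exists => /forallP/(_ j'); rewrite sj' le /= negb_and !negbK.
  (* Seeds sharing an edge also share the date, because spheres of different radii are disjoint. *)
  case/orP=> // /eqP E; case/eqP: ne; move: sj sj'; rewrite /seed E.
  move=> a b; apply/eqP; rewrite -pair_eqE /pair_eq E eqxx andbT.
  by rewrite -val_eqE /= (gsphere_inj a b).
have sub : lball (p * t) u \subset gball c u t.
  apply/fintype.subsetP => x; rewrite inE -[t in gball _ _ t]add0n => h.
  by apply: gball_lball h; rewrite inE.
rewrite -(cardsID (lball (p * t) u) (gball c u t)) (finset.setIidPr sub).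
rewrite card_lball // leq_add2l.
under eq_bigr => j _ do rewrite -(card_lball (c j.2) (nm j)).
apply: sum_card_disjoint => [j gj|i j gi gj ne].
  rewrite finset.subsetD -/(seed_ball c j) disjoint_sym disj // andbT.
  by apply: seed_ball_sub; case/andP: gj.
case/andP: (gi) => si ci; case/andP: (gj) => sj cj.
have [le|/ltnW le] := leqP i.1 j.1; first exact: disj2.
by rewrite disjoint_sym; apply: disj2; rewrite // eq_sym.
Qed.

(** Two balls meet only if their centres are within the sum of the radii. With k = t - 1 - s, each
    such sum is the radius of the older ball at time s + 1 plus 2pk, so [ell_addM] splits off one
    common factor from the volume at s + 1. *)
Lemma card_danger c u (s : 'I_t) e :
  #|danger c u s e| <= ell (p * (t.-1 - s).*2) * growth p q s.+1.
Proof.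
have st := ltn_ord s; set k := t.-1 - s.
apply: leq_trans (leq_mul (leqnn _) (volume_growth c u s.+1)).
pose X (j : 'I_s.+1 * (node m * 'I_q)) := lball (p * (s - j.1) + p * k.*2) (c j.2).
pose F := \bigcup_(j : 'I_s.+1 * (node m * 'I_q) | seed c u j) X j.
apply: (@leq_trans #|lball (p * s.+1 + p * k.*2) u :|: F|).
  apply/subset_leq_card/fintype.subsetP => w; rewrite !inE => /orP[].
    rewrite -finset.setI_eq0 => /set0Pn[x]; rewrite !inE => /andP[ux wx].
    apply/orP; left; apply: leq_trans (latdist_tri x u w) _.
    rewrite [latdist x w]latdist_sym.
    apply: leq_trans (leq_add ux wx) _; rewrite -!mulnDr leq_mul2l.
    by apply/orP; right; rewrite /k; lia.
  case/existsP=> j /and4P[sj _ js]; rewrite -finset.setI_eq0 => /set0Pn[x].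
  rewrite !inE => /andP[ux wx].
  apply/orP; right; apply/bigcupP; exists (Ordinal (js : j.1 < s.+1), j.2) => //.
  rewrite inE /=; apply: leq_trans (latdist_tri x _ w) _.
  rewrite [latdist x w]latdist_sym.
  apply: leq_trans (leq_add ux wx) _; rewrite -!mulnDr leq_mul2l.
  by apply/orP; right; rewrite /k; lia.
apply: leq_trans (leq_card_setU _ _).1 _.
rewrite /volume -(sum_seed s.+1 c u (fun r => ell (p * (s.+1.-1 - r)))) mulnDr.
apply: leq_add; first by apply: leq_trans (card_lball_le _ _) _; rewrite addnC ell_addM.
rewrite big_distrr /=.
rewrite /F; elim/big_ind2: _ => [|A a B b hA hB|j _]; first by rewrite cards0.
  by apply: leq_trans (leq_card_setU _ _).1 _; apply: leq_add.
by apply: leq_trans (card_lball_le _ _) _; rewrite addnC ell_addM.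
Qed.

End Collision.

(* Deferred decisions: the contact of [e] is not consulted before [e.1] lies strictly
   inside the explored ball. *)
Lemma gball_resample c c' u e t :
  (forall e', e' != e -> c e' = c' e') -> e.1 \notin gball c u t ->
  forall s, s <= t.+1 -> gball c u s = gball c' u s.
Proof.
move=> cc' nt; elim=> // s IH st; rewrite /= -IH; last exact: ltnW.
congr (_ :|: _); apply/setP => w; rewrite !inE; apply: eq_existsb => y.
apply: andb_id2l => ys; rewrite /kl_edge; congr (_ || _); apply: eq_existsb => i.
rewrite cc' //; apply: contraNneq nt => <- /=.
exact: (fintype.subsetP (gball_mono c u (st : s <= t))).
Qed.

Lemma gsphere_resample c c' u e t :
  (forall e', e' != e -> c e' = c' e') -> e.1 \in gsphere c u t ->
  forall s, s <= t -> gsphere c u s = gsphere c' u s.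
Proof.
move=> cc'; case: t => [|t] et s; first by rewrite leqn0 => /eqP->.
have nt := gsphere_notin (ltnSn t) et => st.
case: s st => [|s] st //.
by rewrite /gsphere (gball_resample cc' nt st) (gball_resample cc' nt (ltnW st)).
Qed.

(** [danger] leaves out [e] itself and all later seeds, so it is determined by spheres up to radius
    s and by contacts of other edges. *)
Lemma danger_resample t c c' u (s : 'I_t) e :
  (forall e', e' != e -> c e' = c' e') -> e.1 \in gsphere c u s ->
  danger c u s e = danger c' u s e.
Proof.
move=> cc' es; apply/setP => w; rewrite !inE; congr (_ || _).
apply: eq_existsb => j; have [_|ne] := eqVneq j.2 e; first by rewrite !andbF.
have [js|] := leqP j.1 s; last by rewrite !andbF.
by rewrite /seed (gsphere_resample cc' es js) /seed_ball cc'.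
Qed.

End Exploration.

Local Open Scope ring_scope.

(** * The long-range kernel *)

Lemma powR_exprn (R : realType) (x a : R) n : 0 <= x -> (x `^ a) ^+ n = (x ^+ n) `^ a.
Proof.
move=> x0; have h (y : R) : 0 <= y -> y ^+ n = y `^ n%:R by move=> y0; rewrite powR_mulrn.
by rewrite (h _ (powR_ge0 x a)) (h _ x0) powRAC.
Qed.

(** For b < 1 this is Young's inequality with exponents 1/b and 1/(1 - b), applied to x^b and 1. *)
Lemma powR_bernoulli (R : realType) (b x : R) :
  0 < b -> b <= 1 -> 0 <= x -> x `^ b <= b * x + (1 - b).
Proof.
move=> b0; rewrite le_eqVlt => /predU1P[->|b1] x0; first by rewrite powRr1 //; lra.
have := @conjugate_powR _ (x `^ b) 1 b^-1 (1 - b)^-1 (powR_ge0 _ _) ler01.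
rewrite !invr_gt0 subr_gt0 !invrK => /(_ b0 b1).
rewrite mulr1 -powRrM mulfV ?gt_eqF // powRr1 // powR1 mul1r [x * b]mulrC.
by apply; lra.
Qed.

(** [powR_bernoulli] at n/(n + 1) shows that n^b increases by at least b (n + 1)^(b - 1); the
    increments telescope. *)
Lemma sum_powR_le (R : realType) (b : R) n :
  0 < b -> b <= 1 -> \sum_(j < n) j.+1%:R `^ (b - 1) <= n%:R `^ b / b.
Proof.
move=> b0 b1; elim: n => [|n IH].
  by rewrite big_ord0 powR0 ?gt_eqF // mul0r.
rewrite big_ord_recr /=.
have n0 : 0 < n.+1%:R :> R by rewrite ltr0n.
have n0' : n.+1%:R != 0 :> R by rewrite gt_eqF.
have h : n%:R `^ b <= n.+1%:R `^ b * (b * (n%:R / n.+1%:R) + (1 - b)).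
  rewrite {1}(_ : n%:R = n.+1%:R * (n%:R / n.+1%:R) :> R);
    last by rewrite mulrCA mulfV // mulr1.
  have nn : 0 <= n%:R / n.+1%:R :> R by rewrite divr_ge0.
  by rewrite powRM ?ler_wpM2l ?powR_ge0 // powR_bernoulli.
rewrite powRB ?implybF //; last by rewrite n0' implybT.
rewrite powRr1 ?ler0n // ler_pdivlMr // mulrDl.
move: IH; rewrite ler_pdivlMr // => IH.
apply: le_trans (lerD (le_trans IH h) (lexx _)) _.
rewrite -[n%:R](addrK 1) natr1 mulrBl mul1r divff //.
by rewrite le_eqVlt; apply/orP; left; apply/eqP; ring.
Qed.

(** The weight within distance rho is of order rho^(2 - r), the power [theta] of the area rho^2. *)
Definition theta (R : realType) (r : R) : R := 1 - r / 2.

Definition kconst (R : realType) (r : R) : R := 1 + 4 / theta r.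

Lemma theta_gt0 (R : realType) (r : R) : r < 2 -> 0 < theta r.
Proof. by move=> r2; rewrite subr_gt0 ltr_pdivrMr // mul1r. Qed.

Lemma kconst_ge1 (R : realType) (r : R) : r < 2 -> 1 <= kconst r.
Proof. by move=> r2; rewrite lerDl divr_ge0 // ltW // theta_gt0. Qed.

Section Kernel.
Variables (R : realType) (r : R) (m : nat).
Hypotheses (r0 : 0 <= r) (r2 : r < 2) (m1 : (1 < m)%N).
Implicit Types (y w : node m) (D : {set node m}).

Local Notation th := (theta r).
Local Notation C := (kconst r).

Let th0 : 0 < th. Proof. exact: theta_gt0. Qed.
Let th1 : th <= 1. Proof. by rewrite gerBl divr_ge0. Qed.
Let th_r : th + th = 2 - r. Proof. by rewrite /theta; field. Qed.
Let C1 : 1 <= C. Proof. exact: kconst_ge1. Qed.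

Lemma lr_weight_ge0 y w : 0 <= lr_weight r y w.
Proof. exact: powR_ge0. Qed.

Lemma powR_th_sqr (n : nat) : (0 < n)%N ->
  n%:R `^ (- r) * n%:R ^+ 2 = (n%:R `^ th) ^+ 2 :> R.
Proof.
move=> n0; have nn : n%:R != 0 :> R by rewrite pnatr_eq0 -lt0n.
rewrite [RHS]expr2 -powRD ?nn ?implybT // -[n%:R ^+ 2]powR_mulrn // -powRD ?nn ?implybT //.
by congr powR; rewrite th_r addrC.
Qed.

Lemma sum_shell_weight y rho :
  \sum_(w | (0 < latdist y w <= rho)%N) lr_weight r y w <= 4 / th * (rho%:R `^ th) ^+ 2.
Proof.
have -> : \sum_(w | (0 < latdist y w <= rho)%N) lr_weight r y w =
    \sum_(j < rho) #|[set w | latdist y w == j.+1]|%:R * j.+1%:R `^ (- r).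
  under [RHS]eq_bigr => j _ do rewrite mulr_natl -sumr_const.
  rewrite (exchange_big_dep (fun w => 0 < latdist y w <= rho)%N) /=; last first.
    by move=> j w _; rewrite inE => /eqP->; rewrite ltn_ord.
  apply: eq_bigr => w /andP[d0 dr].
  have dr' : ((latdist y w).-1 < rho)%N by rewrite prednK.
  rewrite (bigD1 (Ordinal dr')) /=; last by rewrite inE prednK.
  rewrite big1 ?addr0 /lr_weight ?prednK // => j; rewrite inE -val_eqE /=.
  by case/andP=> /eqP->; rewrite eqxx.
(* As 2 - r may exceed 1, the power 1 - r is split into theta and theta - 1 and the first factor
   bounded by rho^theta; [sum_powR_le] then applies with exponent theta. *)
apply: (@le_trans _ _ (\sum_(j < rho) 4 * rho%:R `^ th * j.+1%:R `^ (th - 1))).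
  apply: ler_sum => j _.
  have j0 : j.+1%:R != 0 :> R by rewrite pnatr_eq0.
  apply: (@le_trans _ _ ((4 * j.+1)%:R * j.+1%:R `^ (- r))).
    by rewrite ler_wpM2r ?powR_ge0 // ler_nat card_latsphere_le.
  rewrite natrM -!mulrA ler_wpM2l //.
  rewrite -{1}[j.+1%:R]powRr1 // -powRD ?j0 ?implybT //.
  rewrite (_ : 1 - r = th + (th - 1)); last by have := th_r; lra.
  rewrite powRD ?j0 ?implybT // ler_wpM2r ?powR_ge0 //.
  by apply: ge0_ler_powR; rewrite ?nnegrE ?ler0n ?ler_nat // ltW.
rewrite -mulr_sumr; apply: le_trans (ler_wpM2l _ (sum_powR_le rho th0 th1)) _.
  by rewrite mulr_ge0 // powR_ge0.
by rewrite le_eqVlt; apply/orP; left; apply/eqP; move: (_ `^ _) th^-1 => X t; ring.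
Qed.

Local Notation M := (m%:R `^ th : R).
Let m0 : (0 < m)%N. Proof. exact: ltnW. Qed.
Let m_neq0 : m%:R != 0 :> R. Proof. by rewrite pnatr_eq0 -lt0n. Qed.
Let M0 : 0 < M. Proof. by rewrite powR_gt0 // ltr0n. Qed.

Lemma lr_weight_ge y w : w != y -> M ^+ 2 / m%:R ^+ 2 <= lr_weight r y w.
Proof.
move=> wy; rewrite -powR_th_sqr // mulfK ?expf_neq0 //.
rewrite /lr_weight !powRN lef_pV2 ?posrE ?powR_gt0 ?ltr0n //.
  by apply: ge0_ler_powR; rewrite ?nnegrE ?ler0n ?ler_nat ?latdist_le.
by rewrite lt0n; apply: contra wy => /eqP/latdist_eq0 ->.
Qed.

Lemma lr_weight_self y : lr_weight r y y <= (r == 0)%:R.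
Proof.
rewrite /lr_weight latdist_refl; case: eqVneq => [->|rn]; first by rewrite oppr0 powRr0.
by rewrite powR0 // oppr_eq0.
Qed.

Lemma card_node : #|{: node m}| = (m ^ 2)%N.
Proof. by rewrite card_prod card_ord mulnn. Qed.

Lemma sum_weight_ge y : M ^+ 2 / 2 <= \sum_w lr_weight r y w.
Proof.
rewrite (bigD1 y) //=; apply: ler_wpDl; first exact: lr_weight_ge0.
apply: (@le_trans _ _ (\sum_(w | w != y) M ^+ 2 / m%:R ^+ 2)); last first.
  by apply: ler_sum => w; apply: lr_weight_ge.
rewrite sumr_const -[leRHS]mulr_natl mulrCA ler_wpM2l ?sqr_ge0 //.
have -> : #|[pred w | w != y]| = (m ^ 2).-1.
  by have := cardC (pred1 y); rewrite card1 card_node add1n => <-.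
rewrite ler_pdivlMr ?exprn_gt0 ?ltr0n // mulrC ler_pdivrMr //.
by rewrite -natrX -natrM ler_nat; nia.
Qed.

Lemma sum_weight_le y : \sum_w lr_weight r y w <= C * M ^+ 2.
Proof.
rewrite (bigD1 y) //= /kconst mulrDl mul1r lerD //.
  apply: le_trans (lr_weight_self y) _; apply: (@le_trans _ _ 1); first by case: eqP.
  by apply: exprn_ege1; rewrite -[leLHS](powRr0 m%:R) ler_powR ?ler1n // ltW.
rewrite (eq_bigl (fun w => 0 < latdist y w <= m)%N); first exact: sum_shell_weight.
move=> w; rewrite latdist_le andbT lt0n; congr negb; apply/eqP/eqP => [->|/latdist_eq0 //].
exact: latdist_refl.
Qed.

Let Z_gt0 y : 0 < \sum_w lr_weight r y w.
Proof. by apply: lt_le_trans (sum_weight_ge y); rewrite divr_gt0 ?exprn_gt0. Qed.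

Lemma lr_prob_ge0 y w : 0 <= lr_prob r y w.
Proof. by rewrite divr_ge0 ?lr_weight_ge0 // ltW. Qed.

Lemma sum_lr_prob y : \sum_w lr_prob r y w = 1.
Proof. by rewrite -mulr_suml divff // gt_eqF. Qed.

Lemma lr_prob_ge y w : w != y -> (C * m%:R ^+ 2)^-1 <= lr_prob r y w.
Proof.
move=> wy; rewrite /lr_prob ler_pdivlMr //.
apply: le_trans (lr_weight_ge wy).
have C0 : 0 < C by apply: lt_le_trans C1.
rewrite invfM mulrAC ler_pM2r ?invr_gt0 ?exprn_gt0 ?ltr0n //.
by rewrite mulrC ler_pdivrMr // mulrC sum_weight_le.
Qed.

Lemma near_sqrt (a : nat) : (0 < a)%N -> exists rho, (0 < rho /\ a <= rho ^ 2 <= 4 * a)%N.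
Proof.
move=> a0; have ex : exists n, (a <= n ^ 2)%N by exists a; nia.
case: (ex_minnP ex) => n an minn; exists n.
case: n an minn => [|[|n]] an minn; [by nia|by split => //; nia|split=> //].
by have := minn n.+1; case: (leqP a (n.+1 ^ 2)) => [_ /(_ isT)|? _]; nia.
Qed.

(** Take rho^2 between a and 4a. Points of [D] within rho weigh at most the full shell sum; the at
    most a others weigh at most rho^(-r) each. Both parts are of order rho^(2 theta). *)
Lemma lr_prob_set_le y D (a : nat) : (0 < a)%N -> (#|D| <= a)%N ->
  \sum_(w in D) lr_prob r y w <= 2 * C * ((4 * a)%:R / (m ^ 2)%:R) `^ th.
Proof.
move=> a0 Da; have [rho [rho0 /andP[ar ra]]] := near_sqrt a0.
pose P := rho%:R `^ th : R.
have h : \sum_(w in D) lr_weight r y w <= C * P ^+ 2.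
  rewrite (bigID (fun w => 0 < latdist y w <= rho)%N) /= addrC /kconst mulrDl mul1r lerD //.
    apply: (@le_trans _ _ (\sum_(w in D) rho%:R `^ (- r))); last first.
      rewrite sumr_const -[leLHS]mulr_natl mulrC -powR_th_sqr // ler_wpM2l ?powR_ge0 //.
      by rewrite -natrX ler_nat (leq_trans Da).
    rewrite big_mkcondr /=; apply: ler_sum => w _; case: ifP => [|_]; last exact: powR_ge0.
    (* The point [y] is counted with the far ones: its weight is 1 = rho^(-r) if r = 0, and 0
       otherwise. *)
    rewrite negb_and -leqNgt leqn0 -ltnNge => /orP[/eqP/latdist_eq0 <-|d].
      apply: le_trans (lr_weight_self _) _; case: eqP => [->|_]; last exact: powR_ge0.
      by rewrite oppr0 powRr0.
    rewrite /lr_weight !powRN lef_pV2 ?posrE ?powR_gt0 ?ltr0n //; last exact: leq_trans d.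
    by apply: ge0_ler_powR; rewrite ?nnegrE ?ler0n ?ler_nat // ltnW.
  apply: le_trans (sum_shell_weight y rho); rewrite [leRHS]big_mkcond [leLHS]big_mkcond.
  apply: ler_sum => w _; case: (w \in D) => //=; case: ifP => // _; exact: lr_weight_ge0.
rewrite -mulr_suml ler_pdivrMr //; apply: le_trans h _.
apply: (@le_trans _ _ (2 * C * ((4 * a)%:R / (m ^ 2)%:R) `^ th * (M ^+ 2 / 2))); last first.
  by rewrite ler_wpM2l ?sum_weight_ge // mulr_ge0 ?powR_ge0 // mulr_ge0 // (le_trans _ C1).
have -> : M ^+ 2 = (m ^ 2)%:R `^ th.
  by rewrite natrX powR_exprn.
have -> : P ^+ 2 = (rho ^ 2)%:R `^ th.
  by rewrite natrX /P powR_exprn.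
have -> : 2 * C * ((4 * a)%:R / (m ^ 2)%:R) `^ th * ((m ^ 2)%:R `^ th / 2) =
          C * (((4 * a)%:R / (m ^ 2)%:R) `^ th * (m ^ 2)%:R `^ th).
  by move: (_ `^ _) (_ `^ _) C => X Y c; field.
rewrite -powRM ?divr_ge0 // divfK; last by rewrite pnatr_eq0 -lt0n expn_gt0 m0.
rewrite ler_wpM2l ?(le_trans _ C1) //.
by apply: ge0_ler_powR; rewrite ?nnegrE ?ler0n ?ler_nat // ltW.
Qed.

End Kernel.

(** * Expectations over configurations *)

Section Expectation.
Variables (R : realType) (r : R) (m q : nat).
Hypotheses (r0 : 0 <= r) (r2 : r < 2) (m1 : (1 < m)%N).
Implicit Types (c : config m q) (e : node m * 'I_q) (F G : config m q -> R).

Definition expect F : R := \sum_c config_prob r c * F c.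

Lemma config_prob_ge0 c : 0 <= config_prob r c.
Proof. by apply: prodr_ge0 => e _; apply: lr_prob_ge0. Qed.

Lemma expect_cst x : expect (fun=> x) = x.
Proof.
rewrite /expect -mulr_suml [X in X * _](_ : _ = 1) ?mul1r //.
rewrite -(bigA_distr_bigA (fun e : node m * 'I_q => lr_prob r e.1)) /=.
by apply: big1 => e _; apply: sum_lr_prob.
Qed.

Lemma expect_le F G : (forall c, F c <= G c) -> expect F <= expect G.
Proof. by move=> FG; apply: ler_sum => c _; rewrite ler_wpM2l ?config_prob_ge0. Qed.

Lemma expectD F G : expect (fun c => F c + G c) = expect F + expect G.
Proof. by rewrite -big_split; apply: eq_bigr => c _; rewrite mulrDr. Qed.

Lemma expectZ x F : expect (fun c => x * F c) = x * expect F.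
Proof. by rewrite /expect mulr_sumr; apply: eq_bigr => c _; rewrite mulrCA. Qed.

Lemma expectB F G : expect (fun c => F c - G c) = expect F - expect G.
Proof. by rewrite -sumrB; apply: eq_bigr => c _; rewrite mulrBr. Qed.

Lemma expect_sum (I : finType) (P : pred I) (F : I -> config m q -> R) :
  expect (fun c => \sum_(i | P i) F i c) = \sum_(i | P i) expect (F i).
Proof. by rewrite exchange_big; apply: eq_bigr => c _; rewrite mulr_sumr. Qed.

Definition reset c e w : config m q := [ffun e' => if e' == e then w else c e'].

Lemma config_prob_reset c e w :
  config_prob r (reset c e w) * lr_prob r e.1 (c e) = config_prob r c * lr_prob r e.1 w.
Proof.
rewrite /config_prob (bigD1 e) //= [in RHS](bigD1 e) //= ffunE eqxx.
rewrite (eq_bigr (fun e' : node m * 'I_q => lr_prob r e'.1 (c e'))); first by ring.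
by move=> e' ne; rewrite ffunE (negbTE ne).
Qed.

(** Swapping the stored contact of [e] with a fresh sample is an involution on pairs that preserves
    their joint weight. *)
Lemma expect_reset F e :
  expect F = expect (fun c => \sum_w lr_prob r e.1 w * F (reset c e w)).
Proof.
symmetry; rewrite /expect; under eq_bigr => c _ do rewrite mulr_sumr.
rewrite pair_bigA /=.
pose h (z : config m q * node m) := (reset z.1 e z.2, z.1 e).
have hK : involutive h.
  move=> [c w]; rewrite /h /= /reset !ffunE eqxx; congr pair; apply/ffunP => e'.
  by rewrite !ffunE; case: eqP => [->|].
rewrite (reindex_inj (inv_inj hK)) /=.
under eq_bigr => z _.
  rewrite mulrA config_prob_reset (_ : reset _ _ _ = z.1); last by case: z (hK z) => ? ? [].
  over.
rewrite -(pair_bigA _ (fun c w => config_prob r c * lr_prob r e.1 w * F c)) /=.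
by apply: eq_bigr => c _; rewrite -mulr_suml -mulr_sumr sum_lr_prob // mulr1 //.
Qed.

(** Neither [A] nor, on [A], the random set [D] depends on the contact of [e]; given [A], that
    contact is therefore a fresh sample. *)
Lemma expect_contact_le (A : config m q -> bool) (D : config m q -> {set node m}) e (d : R) :
  (forall c c', (forall e', e' != e -> c e' = c' e') -> A c -> A c' /\ D c = D c') ->
  (forall c, A c -> \sum_(w in D c) lr_prob r e.1 w <= d) ->
  expect (fun c => (A c && (c e \in D c))%:R) <= d * expect (fun c => (A c)%:R).
Proof.
move=> inv le_d; rewrite (expect_reset _ e) -expectZ; apply: expect_le => c.
have cc' w e' : e' != e -> c e' = reset c e w e' by move=> ne; rewrite ffunE (negbTE ne).
have cc'' w e' : e' != e -> reset c e w e' = c e' by move=> ne; rewrite ffunE (negbTE ne).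
have [Ac|nA] := boolP (A c).
  rewrite mulr1; apply: le_trans (le_d _ Ac); rewrite [leRHS]big_mkcond.
  apply: ler_sum => w _; have [-> <-] := inv _ _ (cc' w) Ac.
  by rewrite ffunE eqxx /=; case: ifP; rewrite (mulr0, mulr1).
rewrite mulr0 big1 // => w _.
have [Aw|] := boolP (A (reset c e w)); last by rewrite mulr0.
by have [Ac _] := inv _ _ (cc'' w) Aw; rewrite Ac in nA.
Qed.

End Expectation.

(** * Expected growth of the explored ball *)

Definition ballconst p := (16 * p ^ 2 + 4 * p + 1)%N.

Lemma ell_exp p k : (ell (p * k.*2) <= ballconst p * 2 ^ k)%N.
Proof.
have h1 : (k < 2 ^ k)%N by apply: ltn_expl.
have h2 : (k ^ 2 <= 2 * 2 ^ k)%N.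
  elim: (k) => // j IH; have : (j < 2 ^ j)%N by apply: ltn_expl.
  by rewrite (expnS 2 j); nia.
rewrite /ell /ballconst -muln2; nia.
Qed.

Section Growth.
Variables (R : realType) (r : R) (m p q : nat).
Hypotheses (r0 : 0 <= r) (r2 : r < 2) (m1 : (1 < m)%N) (p0 : (0 < p)%N) (q0 : (0 < q)%N).
Implicit Types (c : config m q) (u v : node m) (e : node m * 'I_q).

Local Notation E := (@expect R r m q).
Local Notation N := (growth p q).

(** The factor 2^(t - 1 - s) for the enlarged radii is absorbed by the doubling of N from s + 1 to
    t, which makes the bound uniform in s. *)
Lemma card_danger_growth t c u (s : 'I_t) e :
  (#|danger p c u s e| <= ballconst p * N t)%N.
Proof.
apply: leq_trans (card_danger _ _ _ _ _) _.
apply: leq_trans (leq_mul (ell_exp p _) (leqnn _)) _.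
rewrite -mulnA leq_mul2l; apply/orP; right.
apply: leq_trans (growth_expn _ _ p0 q0) _.
by rewrite (_ : (s.+1 + (t.-1 - s))%N = t) //; have := ltn_ord s; lia.
Qed.

Lemma growth_gt0 t : (0 < N t)%N.
Proof. by rewrite growth_rec ltn_addr // /ell addn1. Qed.

Definition collision_rate t : R :=
  2 * kconst r * ((4 * (ballconst p * N t))%:R / (m ^ 2)%:R) `^ theta r.

Lemma collision_rate_ge0 t : 0 <= collision_rate t.
Proof. by rewrite mulr_ge0 ?powR_ge0 // mulr_ge0 // (le_trans _ (kconst_ge1 r2)). Qed.

Lemma expect_collision_le t u (j : 'I_t * (node m * 'I_q)) :
  E (fun c => (seed p c u j && collides p c u j)%:R) <=
  collision_rate t * E (fun c => (seed p c u j)%:R).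
Proof.
apply: (@expect_contact_le _ _ _ _ r0 r2 m1 (fun c => seed p c u j)
  (fun c => danger p c u j.1 j.2) j.2).
  move=> c c' cc' sj; rewrite /seed -(gsphere_resample cc' sj (leqnn _)); split=> //.
  exact: danger_resample.
move=> c _; apply: lr_prob_set_le => //; last exact: card_danger_growth.
by rewrite muln_gt0 growth_gt0 /ballconst addn1.
Qed.

(** Only colliding seeds are lost. Their expected volume is at most the collision rate times the
    expected volume of all seeds, and the latter is at most N_t. *)
Lemma expect_gball_volume t u : ((p * t).*2 < m)%N ->
  E (fun c => (volume p c u t)%:R) - collision_rate t * (N t)%:R <=
  E (fun c => #|gball p c u t|%:R).
Proof.
move=> tm; pose w (j : 'I_t * (node m * 'I_q)) : R := (ell (p * (t.-1 - j.1)))%:R.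
have volE c : (volume p c u t)%:R =
    (ell (p * t))%:R + \sum_j w j * (seed p c u j)%:R.
  rewrite /volume -(sum_seed p t c u (fun s => ell (p * (t.-1 - s)))) natrD natr_sum.
  rewrite big_mkcond; congr (_ + _); apply: eq_bigr => j _.
  by case: (seed _ _ _ _); rewrite (mulr1, mulr0).
have lossE : E (fun c => \sum_j w j * (seed p c u j && collides p c u j)%:R) <=
    collision_rate t * (N t)%:R.
  apply: (@le_trans _ _ (collision_rate t * E (fun c => \sum_j w j * (seed p c u j)%:R))).
    rewrite !expect_sum mulr_sumr; apply: ler_sum => j _.
    by rewrite !expectZ mulrCA ler_wpM2l ?ler0n // expect_collision_le.
  rewrite ler_wpM2l ?collision_rate_ge0 // -(expect_cst q r0 r2 m1 (N t)%:R).
  apply: expect_le => // c; apply: (@le_trans _ _ (volume p c u t)%:R).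
    by rewrite volE lerDr.
  by rewrite ler_nat volume_growth.
rewrite lerBlDr; apply: le_trans (lerD (lexx _) lossE).
rewrite -expectD; apply: expect_le => // c; rewrite volE.
have := card_gball_ge c u tm; rewrite -(ler_nat R) natrD natr_sum => h.
apply: le_trans (lerD h (lexx _)); rewrite -addrA lerD2l.
rewrite [X in _ <= X + _]big_mkcond -big_split /=.
apply: ler_sum => j _; rewrite -/(w j).
by case: (seed _ _ _ _); case: (collides _ _ _ _) => /=; rewrite !(mulr1, mulr0, addr0, add0r).
Qed.

(** Relative losses add up: [volumeE] passes on the losses of earlier times as a common factor, and
    time t adds its own rate. *)
Lemma expect_gball_ge t u : ((p * t).*2 < m)%N ->
  (1 - \sum_(s < t.+1) collision_rate s) * (N t)%:R <= E (fun c => #|gball p c u t|%:R).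
Proof.
elim/ltn_ind: t => t IH tm; apply: le_trans (expect_gball_volume u tm).
rewrite big_ord_recr /= opprD addrA mulrBl lerD2r.
set h := \sum_(_ < _) _.
have h0 : 0 <= h by apply: sumr_ge0 => s _; apply: collision_rate_ge0.
have h1 : 1 - h <= 1 by rewrite gerBl.
apply: (@le_trans _ _ (E (fun c => (ell (p * t))%:R +
    \sum_(s < t) (q * sig p (t.-1 - s))%:R * #|gball p c u s|%:R))); last first.
  apply: expect_le => // c; rewrite volumeE natrD lerD2l big_distrr natr_sum.
  by rewrite /=; apply: ler_sum => s _; rewrite -natrM mulnA.
rewrite expectD (expect_cst _ r0 r2 m1) expect_sum growth_rec natrD mulrDr lerD //.
  by rewrite -[leRHS]mul1r ler_wpM2r.
rewrite big_distrr natr_sum mulr_sumr /=; apply: ler_sum => s _.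
rewrite expectZ mulnA natrM mulrCA ler_wpM2l //.
have st := ltn_ord s; apply: le_trans (IH s st _); last first.
  by apply: leq_ltn_trans tm; rewrite leq_double leq_mul2l ltnW ?orbT.
rewrite ler_wpM2r // lerD2l lerN2 /h.
rewrite -(big_mkord xpredT collision_rate) -(big_mkord xpredT collision_rate).
rewrite (big_cat_nat (leq0n s.+1) st) /= lerDl.
by apply: sumr_ge0 => i _; apply: collision_rate_ge0.
Qed.

Lemma card_gsphereS c u t :
  #|gsphere p c u t.+1|%:R = #|gball p c u t.+1|%:R - #|gball p c u t|%:R :> R.
Proof.
rewrite cardsD (finset.setIidPr (gball_mono p c u (leqnSn t))) natrB //.
exact: subset_leq_card (gball_mono p c u (leqnSn t)).
Qed.

(** Markov's inequality for the deficit N_t - |ball|, which is never negative. The previous ball has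
    at most N_t / 2 points, so a sphere below N_t / 4 forces a deficit above N_t / 4. *)
Lemma expect_small_sphere t u : (0 < t)%N -> ((p * t).*2 < m)%N ->
  E (fun c => (4 * #|gsphere p c u t| < N t)%N%:R) <=
  4 * \sum_(s < t.+1) collision_rate s.
Proof.
move=> t0 tm; have Nt : 0 < (N t)%:R :> R by rewrite ltr0n growth_gt0.
apply: (@le_trans _ _ (4 / (N t)%:R * ((N t)%:R - E (fun c => #|gball p c u t|%:R)))).
  rewrite -[X in _ * (X - _)](expect_cst q r0 r2 m1 (N t)%:R) -expectB -expectZ.
  apply: expect_le => // c; have := card_gball_growth p c u t.
  rewrite -(ler_nat R) => le; case: ltnP => /= [|_]; last first.
    by rewrite mulr_ge0 ?divr_ge0 // subr_ge0.
  move: t0 le Nt => /prednK <-; set s := t.-1 => le Nt small.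
  rewrite mulrAC ler_pdivlMr // mul1r.
  have := growth_double s p0 q0; have := card_gball_growth p c u s.
  rewrite -!(ler_nat R) natrM; move: small; rewrite -(ltr_nat R) natrM card_gsphereS.
  by lra.
rewrite mulrAC ler_pdivrMr //; have := expect_gball_ge u tm.
set S := \sum_(_ < _) _; set x := E _; set n := _%:R; rewrite mulrBl mul1r => h.
by lra.
Qed.

(** Fix the value [A] of the sphere. The contacts of its vertices are still fresh, so one contact
    per vertex already misses [V] with total probability at most (1 - b)^|A|. *)
Lemma expect_miss_le t u (V : {set node m}) (b : R) :
  (forall y, b <= \sum_(w in V) lr_prob r y w) -> 0 <= b ->
  E (fun c => ((N t <= 4 * #|gsphere p c u t|) &&
     [forall y in gsphere p c u t, forall i, c (y, i) \notin V])%N%:R) <=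
  (1 + b * (N t)%:R / 4)^-1.
Proof.
move=> bV b0.
pose i0 : 'I_q := Ordinal q0.
have b1 : b <= 1.
  have [y _] : exists y : node m, true by exists (Ordinal (ltnW m1), Ordinal (ltnW m1)).
  apply: le_trans (bV y) _; rewrite -[leRHS](sum_lr_prob r0 r2 m1 y) [leLHS]big_mkcond.
  by apply: ler_sum => w _; case: ifP => // _; apply: lr_prob_ge0.
have nb0 : 0 <= 1 - b by rewrite subr_ge0.
(* The contacts are exposed one vertex at a time, each costing a factor 1 - b. *)
have step (A : {set node m}) (s : seq (node m)) : uniq s -> {subset s <= A} ->
    E (fun c => ((gsphere p c u t == A) && all (fun y => c (y, i0) \notin V) s)%:R) <=
    (1 - b) ^+ size s * E (fun c => (gsphere p c u t == A)%:R).
  elim: s => [|y s IH] /=.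
    by move=> _ _; rewrite mul1r; apply: expect_le => // c; rewrite andbT.
  case/andP=> ys us sA; rewrite exprS -mulrA.
  apply: le_trans (ler_wpM2l nb0 (IH us _)); last first.
    by move=> z zs; apply: sA; rewrite inE zs orbT.
  apply: le_trans (@expect_contact_le _ _ _ _ r0 r2 m1
    (fun c => (gsphere p c u t == A) && all (fun y => c (y, i0) \notin V) s)
    (fun=> ~: V) (y, i0) (1 - b) _ _).
  - by apply: expect_le => // c; rewrite inE -andbA [all _ _ && _]andbC.
  - move=> c c' cc' /andP[/eqP SA al]; split=> //.
    rewrite -(gsphere_resample (e := (y, i0)) cc' _ (leqnn _)) ?SA ?eqxx /=; last first.
      by apply: sA; rewrite inE eqxx.
    apply/allP => z zs; rewrite -cc'; first exact: (allP al).
    by apply: contraNneq ys => -[<-].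
  - move=> c _; rewrite lerBrDl -(sum_lr_prob r0 r2 m1 y) [leRHS](bigID (mem V)) /=.
    apply: lerD; first exact: bV.
    by rewrite (eq_bigl (fun w => w \notin V)) // => w; rewrite inE.
apply: (@le_trans _ _ (\sum_(A : {set node m})
   (1 + b * (N t)%:R / 4)^-1 * E (fun c => (gsphere p c u t == A)%:R))); last first.
  rewrite -mulr_sumr -expect_sum -[leRHS]mulr1 ler_wpM2l //.
    by rewrite invr_ge0 addr_ge0 // divr_ge0 // mulr_ge0.
  rewrite -[leRHS](expect_cst q r0 r2 m1 1); apply: expect_le => // c.
  rewrite (bigD1 (gsphere p c u t)) //= eqxx big1 ?addr0 // => A.
  by rewrite eq_sym => /negbTE->.
apply: (@le_trans _ _ (\sum_(A : {set node m}) E (fun c =>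
   (N t <= 4 * #|A|)%N%:R * ((gsphere p c u t == A) &&
      all (fun y => c (y, i0) \notin V) (enum A))%:R))).
  rewrite -expect_sum; apply: expect_le => // c.
  rewrite (bigD1 (gsphere p c u t)) //= eqxx /=; apply: ler_wpDr.
    by apply: sumr_ge0 => A _; rewrite mulr_ge0.
  case: leqP => _ /=; last by rewrite mul0r.
  rewrite mul1r ler_nat; case: forallP => // h.
  rewrite (_ : all _ _ = true) //; apply/allP => y; rewrite mem_enum => yS.
  by have /implyP/(_ yS)/forallP/(_ i0) := h y.
apply: ler_sum => A _; rewrite expectZ.
case: leqP => [NA|_]; last first.
  rewrite mul0r mulr_ge0 ?invr_ge0 ?addr_ge0 ?divr_ge0 ?mulr_ge0 //.
  by rewrite -(expect_cst q r0 r2 m1 0); apply: expect_le => // c; rewrite ler0n.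
rewrite mul1r; apply: le_trans (step A (enum A) (enum_uniq _) _) _.
  by move=> y; rewrite mem_enum.
rewrite ler_wpM2r //.
  by rewrite -(expect_cst q r0 r2 m1 0); apply: expect_le => // c; rewrite ler0n.
rewrite -cardE -[leRHS]mul1r ler_pdivlMr; last first.
  by rewrite ltr_pwDl // divr_ge0 // mulr_ge0.
(* Bernoulli's inequality gives 1 + b |A| <= (1 + b)^|A|, and (1 - b)(1 + b) <= 1. *)
apply: (@le_trans _ _ ((1 - b) ^+ #|A| * (1 + b) ^+ #|A|)).
  rewrite ler_wpM2l ?exprn_ge0 //.
  apply: (@le_trans _ _ (1 + b * #|A|%:R)).
    rewrite lerD2l -mulrA ler_wpM2l // ler_pdivrMr // mulrC -natrM ler_nat //.
  elim: #|A| => [|k IH]; first by rewrite mulr0 addr0 expr0.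
  rewrite exprS; apply: le_trans (ler_wpM2l _ IH); last by rewrite addr_ge0.
  rewrite -natr1; have : 0 <= b * b * k%:R by rewrite !mulr_ge0.
  by lra.
have bb : 0 <= b * b by rewrite mulr_ge0.
rewrite -exprMn; apply: exprn_ile1; last by lra.
by rewrite mulr_ge0 // addr_ge0.
Qed.

End Growth.

(** * From the exploration to the distance of a random pair *)

Section Distance.
Variables (R : realType) (r : R) (m p q : nat).
Hypotheses (r0 : 0 <= r) (r2 : r < 2) (m1 : (1 < m)%N) (p0 : (0 < p)%N) (q0 : (0 < q)%N).
Implicit Types (c : config m q) (u v : node m) (e : node m * 'I_q).

Local Notation E := (@expect R r m q).
Local Notation N := (growth p q).

Lemma lr_prob_lball_ge rho y v : ((p * rho).*2 < m)%N ->
  rho%:R ^+ 2 / (kconst r * m%:R ^+ 2) <= \sum_(w in lball (p * rho) v) lr_prob r y w.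
Proof.
move=> rm; have C0 : 0 < kconst r by apply: lt_le_trans (kconst_ge1 r2).
(* The pointwise lower bound does not cover [y], so it is removed; [ell (p * rho)] still leaves
   rho^2 points. *)
apply: (@le_trans _ _ (\sum_(w in lball (p * rho) v :\ y) (kconst r * m%:R ^+ 2)^-1)).
  rewrite sumr_const -[leRHS]mulr_natl ler_wpM2r ?invr_ge0 ?mulr_ge0 ?(ltW C0) ?exprn_ge0 //.
  rewrite -natrX ler_nat; have := cardsD1 y (lball (p * rho) v).
  have le : (rho ^ 2 <= (p * rho) ^ 2)%N by rewrite leq_sqr leq_pmull.
  by rewrite card_lball // /ell; case: (y \in _) => /=; lia.
rewrite [leLHS]big_mkcond [leRHS]big_mkcond; apply: ler_sum => w _; rewrite !inE.
have [_|wy] /= := eqVneq w y; first by case: ifP => // _; apply: lr_prob_ge0.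
by case: ifP => // _; apply: lr_prob_ge.
Qed.

Lemma good_dist t rho c u v (eps : R) : (0 < t)%N -> rho.+1%:R <= eps * t%:R ->
  v \notin gball p c u t ->
  ~~ [forall y in gsphere p c u t, forall i, c (y, i) \notin lball (p * rho) v] ->
  exists k, kl_dist_is p c u v k /\ `|k%:R / t%:R - 1| <= eps.
Proof.
move=> t0 re vt; rewrite negb_forall => /existsP[y].
rewrite negb_imply => /andP[yt]; rewrite negb_forall => /existsP[i].
rewrite negbK inE latdist_sym => h.
have yb := fintype.subsetP (gsphere_sub p c u t) _ yt.
(* At most t steps to [y], one long-range edge, then rho jumps. *)
have vb := gball_lball (gball_contact (e := (y, i)) yb) h.
have [k [dk tk kt]] := kl_dist_exists vt vb.
exists k; split=> //.
have tR : 0 < t%:R :> R by rewrite ltr0n.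
have -> : k%:R / t%:R - 1 = (k%:R - t%:R) / t%:R :> R.
  by rewrite mulrBl divff // gt_eqF.
rewrite ger0_norm; last by rewrite divr_ge0 // subr_ge0 ler_nat ltnW.
rewrite ler_pdivrMr //; apply: le_trans re.
by rewrite lerBlDl -natrD ler_nat addnS -addSn.
Qed.

(** The three terms are the ways to fail: [v] is already in the ball, the sphere is small, or a
    large sphere misses the neighbourhood of [v]. Only the first needs the average over [v]. *)
Lemma bad_prob_le t rho (eps : R) : (0 < t)%N -> ((p * t).*2 < m)%N ->
  ((p * rho).*2 < m)%N -> rho.+1%:R <= eps * t%:R ->
  bad_prob r p q m t%:R eps <=
  (N t)%:R / m%:R ^+ 2 + 4 * \sum_(s < t.+1) collision_rate r m p q s +
  (1 + rho%:R ^+ 2 / (kconst r * m%:R ^+ 2) * (N t)%:R / 4)^-1.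
Proof.
move=> t0 tm rm re.
set h2 := 4 * _; set h3 := (1 + _)^-1.
pose n2 := #|{: node m}|%:R : R.
have n2E : n2 = m%:R ^+ 2 by rewrite /n2 card_node natrX.
have n20 : 0 < n2 by rewrite n2E exprn_gt0 // ltr0n ltnW.
pose miss c u v := (N t <= 4 * #|gsphere p c u t|)%N &&
  [forall y in gsphere p c u t, forall i, c (y, i) \notin lball (p * rho) v].
pose F c u v : R := (v \in gball p c u t)%:R + (4 * #|gsphere p c u t| < N t)%N%:R
  + (miss c u v)%:R.
have F0 c u v : 0 <= F c u v by rewrite !addr_ge0.
apply: (@le_trans _ _ (\sum_c \sum_u \sum_v config_prob r c / n2 ^+ 2 * F c u v)).
  rewrite /bad_prob; apply: ler_sum => c _; apply: ler_sum => u _; apply: ler_sum => v _.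
  have P0 : 0 <= config_prob r c / n2 ^+ 2.
    by rewrite divr_ge0 ?config_prob_ge0 // exprn_ge0 // ltW.
   case: ifP => [/asboolP bad|_]; last by rewrite mulr_ge0.
  rewrite -[leLHS]mulr1 ler_wpM2l // /F /miss.
  have [vt|vt] := boolP (v \in _); first by rewrite -addrA lerDl addr_ge0.
  have [le|lt] := leqP (N t) (4 * #|gsphere p c u t|); last by rewrite add0r lerDl.
  have [al|nal] := boolP [forall y in gsphere p c u t,
    forall i, c (y, i) \notin lball (p * rho) v]; first by rewrite !add0r.
  by exfalso; apply: bad; apply: good_dist nal.
have -> : \sum_c \sum_u \sum_v config_prob r c / n2 ^+ 2 * F c u v =
    (n2 ^+ 2)^-1 * \sum_u E (fun c => \sum_v F c u v).
  rewrite /expect mulr_sumr exchange_big /=; apply: eq_bigr => u _.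
  rewrite mulr_sumr; apply: eq_bigr => c _; rewrite mulr_sumr mulr_sumr.
  by apply: eq_bigr => v _; rewrite mulrA [_^-1 * _]mulrC.
have bound u : E (fun c => \sum_v F c u v) <= n2 * ((N t)%:R / m%:R ^+ 2 + h2 + h3).
  have -> : n2 * ((N t)%:R / m%:R ^+ 2 + h2 + h3) = (N t)%:R + n2 * h2 + n2 * h3.
    by rewrite !mulrDr -n2E mulrCA divff ?mulr1 // gt_eqF.
  have -> : E (fun c => \sum_v F c u v) =
      E (fun c => #|gball p c u t|%:R)
      + \sum_(v : node m) E (fun c => (4 * #|gsphere p c u t| < N t)%N%:R)
      + \sum_v E (fun c => (miss c u v)%:R).
    rewrite -!expect_sum -!expectD; apply: eq_bigr => c _; congr (_ * _).
    rewrite /F !big_split /= -[in RHS]sum1_card natr_sum [in RHS]big_mkcond /=.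
    by congr (_ + _ + _); apply: eq_bigr => v _; case: (v \in _).
  rewrite !lerD //.
  - rewrite -[leRHS](expect_cst q r0 r2 m1 (N t)%:R); apply: expect_le => // c.
    by rewrite ler_nat card_gball_growth.
  - rewrite sumr_const -[leLHS]mulr_natl ler_wpM2l ?(ltW n20) //; exact: expect_small_sphere.
  - rewrite [leRHS]mulr_natl -sumr_const; apply: ler_sum => v _.
    apply: expect_miss_le => // [y|]; first exact: lr_prob_lball_ge.
    by rewrite divr_ge0 ?exprn_ge0 ?mulr_ge0 // (le_trans _ (kconst_ge1 r2)).
apply: (@le_trans _ _ ((n2 ^+ 2)^-1 * (n2 * (n2 * ((N t)%:R / m%:R ^+ 2 + h2 + h3))))).
  rewrite ler_wpM2l ?invr_ge0 ?exprn_ge0 ?(ltW n20) // [leRHS]mulr_natl -sumr_const.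
  by apply: ler_sum => u _.
by rewrite [n2 * (n2 * _)]mulrA -expr2 mulKf // expf_neq0 // gt_eqF.
Qed.

End Distance.

(** * Choice of the typical distance *)

Section Horizon.
Variables (p q : nat).
Hypotheses (p0 : (0 < p)%N) (q0 : (0 < q)%N).
Local Notation N := (growth p q).

(** The factor t + 1 makes N_T / n tend to 0. Since t < N_t, the range contains every candidate. *)
Definition horizon n := (\max_(t < n.+1 | N t * t.+1 <= n) t)%N.

Lemma growth_gt t : (t < N t)%N.
Proof.
apply: (@leq_trans (2 ^ t)); first exact: ltn_expl.
by have := growth_expn 0 t p0 q0; rewrite muln1 add0n.
Qed.

Lemma horizon_ge n t : (N t * t.+1 <= n)%N -> (t <= horizon n)%N.
Proof.
move=> h; have tn : (t < n.+1)%N.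
  by have := growth_gt t; move: h; nia.
exact: (@leq_bigmax_cond _ (fun t : 'I_n.+1 => N t * t.+1 <= n)%N (fun t => t : nat)
  (Ordinal tn)).
Qed.

Lemma horizon_le n : (0 < n)%N -> (N (horizon n) * (horizon n).+1 <= n)%N.
Proof.
move=> n0; rewrite /horizon.
have [] := @eq_bigmax_cond _ [pred t : 'I_n.+1 | N t * t.+1 <= n]%N (fun t => t : nat).
  by apply/card_gt0P; exists ord0; rewrite inE.
by move=> t h ->; rewrite inE in h.
Qed.

Lemma horizon_lt n : (n < N (horizon n).+1 * (horizon n).+2)%N.
Proof. by rewrite ltnNge; apply/negP => /horizon_ge; rewrite ltnn. Qed.

(** With j = t / 3 rounded down, t^3 <= 27 (j + 1)^3 <= 27 * 2^t. This later keeps the balls of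
    radius pT from wrapping around. *)
Lemma square_lt_exp a t : (27 * a < t)%N -> (a * t ^ 2 < 2 ^ t)%N.
Proof.
move=> lt_at; set j := (t %/ 3)%N.
have jt : (t < 3 * j.+1)%N by rewrite mulnC -ltn_divLR.
have h : (j.+1 ^ 3 <= 2 ^ t)%N.
  apply: (@leq_trans ((2 ^ j) ^ 3)).
    by rewrite leq_exp2r // ltn_expl.
  by rewrite -expnM leq_exp2l // leq_trunc_div.
apply: leq_trans h; rewrite -(ltn_pmul2l (isT : 0 < 27)%N) mulnA.
apply: (@leq_trans (t ^ 3)).
  by rewrite (expnS t 2) ltn_pmul2r // expn_gt0 (leq_ltn_trans _ lt_at).
rewrite (_ : 27 * j.+1 ^ 3 = (3 * j.+1) ^ 3)%N; last by rewrite expnMn.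
by rewrite leq_exp2r // ltnW.
Qed.

End Horizon.

(** * Vanishing of the error terms at the horizon *)

Section Convergence.
Variables (R : realType) (r : R) (p q : nat).
Hypotheses (r0 : 0 <= r) (r2 : r < 2) (p0 : (0 < p)%N) (q0 : (0 < q)%N).
Local Notation N := (growth p q).

Definition halfpow : R := 2^-1 `^ theta r.

Lemma halfpow_lt1 : halfpow < 1.
Proof.
have := @gt0_ltr_powR _ (theta r) (theta_gt0 r2) 2^-1 1.
rewrite powR1 !nnegrE invr_ge0 ler0n ler01; apply=> //.
by rewrite invf_lt1 // ltr1n.
Qed.

Definition sumconst : R :=
  2 * kconst r * (4 * ballconst p)%:R `^ theta r / (1 - halfpow).

(** As N doubles, going back one step multiplies the bound on the rate by [halfpow], so the sum is
    geometric; N_t / m^2 <= 1/(t + 1) bounds its largest term. *)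
Lemma sum_collision_le m t : (1 < m)%N -> (N t * t.+1 <= m ^ 2)%N ->
  \sum_(s < t.+1) collision_rate r m p q s <= sumconst * t.+1%:R^-1 `^ theta r.
Proof.
move=> m1 Nm; have x1 := halfpow_lt1; have x0 : 0 <= halfpow by apply: powR_ge0.
have k0 : 0 <= 2 * kconst r by rewrite mulr_ge0 // (le_trans _ (kconst_ge1 r2)).
have m20 : 0 < (m ^ 2)%:R :> R by rewrite ltr0n expn_gt0 ltnW.
pose A := 2 * kconst r * (4 * ballconst p)%:R `^ theta r * t.+1%:R^-1 `^ theta r.
have A0 : 0 <= A by rewrite !mulr_ge0 ?powR_ge0 // (le_trans _ (kconst_ge1 r2)).
apply: (@le_trans _ _ (\sum_(s < t.+1) A * halfpow ^+ (t - s))).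
  apply: ler_sum => s _; rewrite /collision_rate /A -!mulrA ler_wpM2l // ler_wpM2l //.
    by rewrite (le_trans _ (kconst_ge1 r2)).
  have -> : halfpow ^+ (t - s) = ((2^-1) ^+ (t - s)) `^ theta r.
    by rewrite /halfpow powR_exprn ?invr_ge0.
  rewrite -!powRM ?mulr_ge0 ?exprn_ge0 ?invr_ge0 //.
  apply: ge0_ler_powR; rewrite ?nnegrE ?mulr_ge0 ?exprn_ge0 ?invr_ge0 //.
    by rewrite ltW // theta_gt0.
  have st : (s <= t)%N by rewrite -ltnS.
  have := growth_expn s (t - s) p0 q0; rewrite subnKC // => g.
  have le : (N s)%:R <= t.+1%:R^-1 * (2 ^+ (t - s))^-1 * (m ^ 2)%:R :> R.
    rewrite -invfM mulrC ler_pdivlMr; last by rewrite mulr_gt0 ?ltr0n ?exprn_gt0.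
    rewrite -natrX -!natrM ler_nat; apply: leq_trans Nm.
    by rewrite mulnCA mulnC leq_mul2r [(N s * _)%N]mulnC g orbT.
  by rewrite exprVn ler_pdivrMr // mulnA natrM -!mulrA ler_wpM2l // mulrA.
rewrite -mulr_sumr /sumconst -/A.
have -> : 2 * kconst r * (4 * ballconst p)%:R `^ theta r / (1 - halfpow) *
    t.+1%:R^-1 `^ theta r = A * (1 - halfpow)^-1 by rewrite /A mulrAC.
rewrite ler_wpM2l // -[leRHS]mul1r ler_pdivlMr ?subr_gt0 //.
rewrite (reindex_inj rev_ord_inj) /=.
under eq_bigr => s _ do rewrite subSS (subKn (ltn_ord s : s <= t)%N).
have := subrX1 halfpow t.+1; set S := \sum_(_ < _) _ => h.
have : 0 <= halfpow ^+ t.+1 by rewrite exprn_ge0.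
have -> : S * (1 - halfpow) = 1 - halfpow ^+ t.+1 by rewrite mulrC -opprB mulNr -h opprB.
by lra.
Qed.

Lemma bad_prob_horizon (eps : R) k m t : t = horizon p q (m ^ 2) ->
  2 <= eps * k%:R -> (2 * k <= t)%N -> (27 * (4 * p ^ 2) < t)%N ->
  bad_prob r p q m t%:R eps <=
  t.+1%:R^-1 + 4 * sumconst * t.+1%:R^-1 `^ theta r +
  48 * kconst r * (ell p + q)%:R * k%:R ^+ 2 / t%:R.
Proof.
move=> tE ek kt pt; have t0 : (0 < t)%N by apply: leq_ltn_trans pt.
have k0 : (0 < k)%N.
  rewrite lt0n; apply: contraTneq ek => ->.
  by rewrite mulr0 -ltNge ltr0n.
have eps0 : 0 <= eps.
  have : 0 <= eps * k%:R by apply: le_trans ek.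
  by rewrite pmulr_lge0 // ltr0n.
have m0 : (0 < m ^ 2)%N.
  rewrite lt0n; apply: contraTneq t0 => E; rewrite tE E /horizon -leqNgt.
  by apply/bigmax_leqP => i _; rewrite -ltnS.
have Nt := horizon_le p q m0; rewrite -tE in Nt.
have tN := horizon_lt p0 q0 (m ^ 2); rewrite -tE in tN.
have tm : ((p * t).*2 < m)%N.
  rewrite -ltn_sqr; apply: leq_trans Nt; apply: (@leq_trans (2 ^ t)).
    by apply: leq_ltn_trans (square_lt_exp pt); rewrite -muln2; lia.
  apply: (@leq_trans (N t)); last by rewrite leq_pmulr.
  by have := growth_expn 0 t p0 q0; rewrite muln1 add0n.
have m1 : (1 < m)%N by apply: leq_ltn_trans tm; rewrite double_gt0 muln_gt0 p0.
(* With k at least 2/eps, rho + 1 is at most eps t; for fixed k, rho^2 is still of order t^2. *)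
pose rho := (t %/ k)%N.
have rm : ((p * rho).*2 < m)%N.
  by apply: leq_ltn_trans tm; rewrite leq_double leq_mul2l leq_div orbT.
have kR : 0 < k%:R :> R by rewrite ltr0n.
have rk : rho%:R * k%:R <= t%:R :> R by rewrite -natrM ler_nat leq_trunc_div.
have kt' : 2 * k%:R <= t%:R :> R by rewrite -natrM ler_nat.
have re : rho.+1%:R <= eps * t%:R.
  rewrite -(ler_pM2r kR) -natr1 mulrDl mul1r.
  apply: (@le_trans _ _ (2 * t%:R)); first by lra.
  by rewrite mulrAC ler_wpM2r.
have rho2 : (t <= rho * (2 * k))%N.
  have := ltn_ceil t k0; rewrite -/rho; nia.
have C1 := kconst_ge1 r2; have C0 : 0 < kconst r by apply: lt_le_trans C1.
have mR : 0 < m%:R ^+ 2 :> R by rewrite exprn_gt0 // ltr0n ltnW.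
have tR : 0 < t%:R :> R by rewrite ltr0n.
have NR : 0 < (N t)%:R :> R by rewrite ltr0n growth_gt0.
apply: le_trans (bad_prob_le r0 r2 m1 p0 q0 t0 tm rm re) _.
apply: lerD; first apply: lerD.
- rewrite ler_pdivrMr // mulrC -ler_pdivrMr ?invr_gt0 ?ltr0n // invrK.
  by rewrite -natrX -natrM ler_nat.
- by rewrite -mulrA ler_wpM2l //; apply: sum_collision_le.
set K := (ell p + q)%:R; have K0 : 0 < K by rewrite /K ltr0n /ell addn1.
set x := _ / 4; set y := _ / _.
have y0 : 0 < y by rewrite divr_gt0 // !mulr_gt0 // exprn_gt0.
rewrite -[y]invrK lef_pV2 ?posrE ?invr_gt0 //; last first.
  by rewrite ltr_pwDl // /x !mulr_ge0 ?invr_ge0 ?exprn_ge0 ?mulr_ge0 // ltW.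
apply: (@le_trans _ _ x); last by rewrite lerDr.
(* Maximality of t gives m^2 < N_(t+1) (t + 2); then [growth_ratio] and t + 2 <= 3t. The constant 48
   is this 3, the 4 of [h2] and the 4 in [x]. *)
have h1 : m%:R ^+ 2 <= K * (N t)%:R * (3 * t%:R) :> R.
  rewrite /K -natrX -!natrM ler_nat; apply: leq_trans (ltnW tN) _.
  apply: leq_mul; first exact: (growth_ratio q t p0).
  by move: t0; clear; lia.
have h2 : t%:R ^+ 2 <= 4 * k%:R ^+ 2 * rho%:R ^+ 2 :> R.
  rewrite -!natrX -!natrM ler_nat (_ : 4 * _ * _ = (rho * (2 * k)) ^ 2)%N ?leq_sqr //.
  by rewrite !expnMn; ring.
rewrite /y invf_div /x.
rewrite ler_pdivrMr ?mulr_gt0 ?exprn_gt0 //.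
have -> : rho%:R ^+ 2 / (kconst r * m%:R ^+ 2) * (N t)%:R / 4 *
    (48 * kconst r * K * k%:R ^+ 2) =
    (rho%:R ^+ 2 * (N t)%:R * 12 * K * k%:R ^+ 2) / m%:R ^+ 2.
  by field; rewrite !gt_eqF // ltr0n ltnW.
rewrite ler_pdivlMr //; apply: (le_trans (ler_wpM2l (ltW tR) h1)).
have -> : t%:R * (K * (N t)%:R * (3 * t%:R)) = 3 * K * (N t)%:R * t%:R ^+ 2 :> R by ring.
have -> : rho%:R ^+ 2 * (N t)%:R * 12 * K * k%:R ^+ 2 =
   3 * K * (N t)%:R * (4 * k%:R ^+ 2 * rho%:R ^+ 2) :> R by ring.
by rewrite ler_wpM2l // !mulr_ge0 // ltW.
Qed.

Lemma bad_prob_ge0 m (x eps : R) : (1 < m)%N -> 0 <= bad_prob r p q m x eps.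
Proof.
move=> m1; do 3 (apply: sumr_ge0 => ? _).
by case: ifP => // _; rewrite divr_ge0 ?exprn_ge0 // config_prob_ge0.
Qed.

End Convergence.

Lemma nat_above (R : realType) (x : R) : exists n : nat, x <= n%:R.
Proof.
exists (Num.bound `|x|); apply: le_trans (ler_norm x) _.
by apply: ltW; apply: archi_boundP.
Qed.

Local Open Scope classical_set_scope.
Local Open Scope ring_scope.

Theorem theorem3 (R : realType) (p q : nat) (r : R) :
  (1 <= p)%N -> (1 <= q)%N -> 0 <= r -> r < 2 ->
  exists f : nat -> R,
    forall eps : R, 0 < eps ->
      (fun m : nat => bad_prob r p q m (f (m ^ 2)%N) eps) @ \oo --> (0 : R).
Proof.
move=> p0 q0 r0 r2; exists (fun n => (horizon p q n)%:R) => eps eps0.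
have [k] := nat_above (2 / eps); rewrite ler_pdivrMr // mulrC => ek.
have th0 := theta_gt0 r2.
apply/cvgrPdist_le => d d0.
have d3 : 0 < d / 3 by rewrite divr_gt0.
have S0 : 0 < 4 * sumconst r p.
  rewrite mulr_gt0 // divr_gt0 ?subr_gt0 ?halfpow_lt1 // !mulr_gt0 //.
    by apply: lt_le_trans (kconst_ge1 r2).
  by rewrite powR_gt0 // ltr0n muln_gt0 /ballconst addn1.
pose c := 48 * kconst r * (ell p + q)%:R * k%:R ^+ 2.
(* Each error term gets d / 3; [z] is the value of 1/(t + 1) at which the second one equals it. *)
pose z := (d / 3 / (4 * sumconst r p)) `^ (theta r)^-1.
have z0 : 0 < z by rewrite powR_gt0 // divr_gt0.
have [n1 hn1] := nat_above (d / 3)^-1.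
have [n2 hn2] := nat_above z^-1.
have [n3 hn3] := nat_above (c / (d / 3)).
have [T [T1 T2 T3 Tk Tp]] : exists T, [/\ n1 <= T, n2 <= T, n3 <= T, 2 * k <= T &
    27 * (4 * p ^ 2) < T]%N.
  by exists (n1 + n2 + n3 + 2 * k + 27 * (4 * p ^ 2)).+1; clear; split; lia.
(* This size of m makes T admissible in [horizon] at m^2; the extra 2 gives m > 1. *)
exists (growth p q T * T.+1).+2 => // m /= Tm.
have m1 : (1 < m)%N by apply: leq_trans Tm.
have Tt : (T <= horizon p q (m ^ 2))%N.
  apply: horizon_ge => //; apply: leq_trans (ltnW (ltnW Tm)) _.
  by rewrite -mulnn leq_pmulr // ltnW.
rewrite sub0r normrN ger0_norm ?bad_prob_ge0 //.
apply: le_trans (bad_prob_horizon r0 r2 p0 q0 erefl ek _ _) _.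
- exact: leq_trans Tt.
- exact: leq_trans Tt.
set t := horizon _ _ _ in Tt *.
have tR : 0 < t%:R :> R by rewrite ltr0n; apply: leq_trans Tt; apply: leq_ltn_trans Tp.
have le_t n : (n <= T)%N -> n%:R <= t%:R :> R by move=> h; rewrite ler_nat (leq_trans h).
have le_t1 n : (n <= T)%N -> n%:R <= t.+1%:R :> R.
  by move=> h; rewrite ler_nat ltnW // ltnS (leq_trans h).
rewrite (_ : d = d / 3 + d / 3 + d / 3); last by field.
apply: lerD; first apply: lerD.
- rewrite -[d / 3]invrK lef_pV2 ?posrE ?ltr0n ?invr_gt0 //.
  by apply: le_trans hn1 _; apply: le_t1.
- rewrite mulrC -ler_pdivlMr //.
  apply: (@le_trans _ _ (z `^ theta r)); last first.
    by rewrite /z -powRrM mulVf ?gt_eqF // powRr1 // ltW // divr_gt0.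
  apply: ge0_ler_powR; rewrite ?nnegrE ?invr_ge0 ?(ltW z0) ?(ltW th0) //.
  rewrite -[z]invrK lef_pV2 ?posrE ?ltr0n ?invr_gt0 //.
  by apply: le_trans hn2 _; apply: le_t1.
- rewrite -/c ler_pdivrMr // mulrC -ler_pdivrMr //.
  by apply: le_trans hn3 _; apply: le_t.
Qed.
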